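(* When $p\equiv 1\mod 4$ is a prime, then $${}_3F_2\!\left(\begin{matrix}\frac12,\ \frac12,\ \frac12\\ 1,\ 1\end{matrix};\,\frac{-1}8\right)_{\frac{p-1}2}=\sum_{k=0}^{\frac{p-1}2}\frac{\left(\frac12\right)_k^3}{k!^3}\left(\frac{-1}{8}\right)^k\equiv\, -(-1)^{\frac{p^2-1}8}\Gamma_p\left(\frac14\right)^4 \mod p^3.$$
   Context: $(a)_k=a(a+1)\cdots(a+k-1)$ is the rising factorial, the subscript $\frac{p-1}{2}$ denotes truncation of the hypergeometric series after the $k=\frac{p-1}2$ term, and $\Gamma_p$ denotes the Morita $p$-adic Gamma function. *)

(* Defs.v *)
From HB Require Import structures.
From mathcomp Require Import all_boot all_order all_algebra.
From mathcomp Require Import boolp classical_sets filter topology.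

Set Implicit Arguments.
Unset Strict Implicit.
Unset Printing Implicit Defensive.

Import GRing.Theory.
Local Open Scope ring_scope.

Definition congruent (R : comNzRingType) (m x y : R) : Prop :=
  exists z, x - y = m * z.

Section Hypergeometric.
Variable F : fieldType.

Definition rising_factorial (a : F) (k : nat) : F := \prod_(i < k) (a + i%:R).

(* Terms of index 0 to n of the hypergeometric series with upper parameters a
   and lower parameters b; a p+1Fp series has one more upper parameter, the
   matching lower one being the 1 that contributes k!. *)
Definition hypergeometric_trunc (a b : seq F) (z : F) (n : nat) : F :=
  \sum_(k < n.+1)
    (\prod_(x <- a) rising_factorial x k) / (\prod_(y <- b) rising_factorial y k)
    * (z ^+ k / k`!%:R).

End Hypergeometric.

(* Z_p as the inverse limit of the Z/p^n: [residue x n] is the representative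
   of x modulo p^n in [0, p^n). *)
Record padic_int (p : nat) (p_pr : prime p) := PadicInt {
  residue : nat -> nat;
  residueP : forall n, (residue n.+1 %% p ^ n)%N = residue n }.

Section PadicRing.
Variables (p : nat) (p_pr : prime p).
Local Notation Zp := (padic_int p_pr).
Implicit Types x y z : Zp.

HB.instance Definition _ := gen_eqMixin Zp.
HB.instance Definition _ := gen_choiceMixin Zp.

Lemma padic_intP x y : (forall n, residue x n = residue y n) -> x = y.
Proof.
case: x y => [u Pu] [v Pv] /= /funext uv; move: Pu Pv; rewrite uv => Pu Pv.
by congr PadicInt; exact: Prop_irrelevance.
Qed.

Lemma residue_mod x n : (residue x n %% p ^ n)%N = residue x n.
Proof. by rewrite -residueP modn_mod. Qed.

Lemma residue_modS x n : residue x n.+1 = residue x n %[mod p ^ n].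
Proof. by rewrite residueP residue_mod. Qed.

Lemma expp_gt0 n : (0 < p ^ n)%N.
Proof. by rewrite expn_gt0 prime_gt0. Qed.

Lemma residue_lt x n : (residue x n < p ^ n)%N.
Proof. by rewrite -residue_mod ltn_mod expp_gt0. Qed.

Section Make.
Variable u : nat -> nat.
Hypothesis uP : forall n, u n.+1 = u n %[mod p ^ n].

Lemma padic_mk_subproof n : ((u n.+1 %% p ^ n.+1) %% p ^ n = u n %% p ^ n)%N.
Proof. by rewrite modn_dvdm ?dvdn_exp2l. Qed.

Definition padic_mk : Zp := PadicInt p_pr padic_mk_subproof.
End Make.

Lemma padic_nat_subproof (k n : nat) : k = k %[mod p ^ n]. Proof. by []. Qed.

Lemma padic_add_subproof x y n :
  (residue x n.+1 + residue y n.+1 = residue x n + residue y n %[mod p ^ n])%N.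
Proof. by rewrite -modnDm !residueP. Qed.

Lemma padic_mul_subproof x y n :
  (residue x n.+1 * residue y n.+1 = residue x n * residue y n %[mod p ^ n])%N.
Proof. by rewrite -modnMm !residueP. Qed.

Lemma padic_opp_subproof x n :
  (p ^ n.+1 - residue x n.+1 = p ^ n - residue x n %[mod p ^ n])%N.
Proof.
apply/eqP; rewrite -(eqn_modDr (residue x n.+1)) subnK; last exact/ltnW/residue_lt.
rewrite -[X in _ == X]modnDmr residueP subnK; last exact/ltnW/residue_lt.
by rewrite modnn expnS modnMl.
Qed.

Definition padic_nat k : Zp := padic_mk (padic_nat_subproof k).
Definition padic_add x y : Zp := padic_mk (padic_add_subproof x y).
Definition padic_mul x y : Zp := padic_mk (padic_mul_subproof x y).
Definition padic_opp x : Zp := padic_mk (padic_opp_subproof x).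

Lemma padic_addA : associative padic_add.
Proof. by move=> x y z; apply: padic_intP => n /=; rewrite modnDmr modnDml addnA. Qed.
Lemma padic_addC : commutative padic_add.
Proof. by move=> x y; apply: padic_intP => n /=; rewrite addnC. Qed.
Lemma padic_add0 : left_id (padic_nat 0) padic_add.
Proof. by move=> x; apply: padic_intP => n /=; rewrite mod0n residue_mod. Qed.
Lemma padic_addN : left_inverse (padic_nat 0) padic_opp padic_add.
Proof.
move=> x; apply: padic_intP => n /=; rewrite modnDml subnK ?modnn ?mod0n //.
exact/ltnW/residue_lt.
Qed.

HB.instance Definition _ :=
  GRing.isZmodule.Build Zp padic_addA padic_addC padic_add0 padic_addN.

Lemma padic_mulA : associative padic_mul.
Proof. by move=> x y z; apply: padic_intP => n /=; rewrite modnMmr modnMml mulnA. Qed.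
Lemma padic_mulC : commutative padic_mul.
Proof. by move=> x y; apply: padic_intP => n /=; rewrite mulnC. Qed.
Lemma padic_mul1 : left_id (padic_nat 1) padic_mul.
Proof. by move=> x; apply: padic_intP => n /=; rewrite modnMml mul1n residue_mod. Qed.
Lemma padic_mulDl : left_distributive padic_mul padic_add.
Proof.
by move=> x y z; apply: padic_intP => n /=; rewrite modnMml mulnDl modnDm.
Qed.
Lemma padic_1neq0 : padic_nat 1 != padic_nat 0.
Proof.
apply/eqP => /(congr1 (fun x => residue x 1)) /=.
by rewrite expn1 mod0n modn_small ?prime_gt1.
Qed.

HB.instance Definition _ := GRing.Zmodule_isComNzRing.Build Zp
  padic_mulA padic_mulC padic_mul1 padic_mulDl padic_1neq0.

Definition padic_unit : {pred Zp} := fun x => `[< exists y : Zp, y * x = 1 >].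
Definition padic_inv x : Zp := xget x [set y | y * x = 1]%classic.

Lemma padic_mulVx : {in padic_unit, left_inverse 1 padic_inv *%R}.
Proof. by move=> x /asboolP ux; exact: (xgetPex x ux). Qed.
Lemma padic_unitPl x y : y * x = 1 -> padic_unit x.
Proof. by move=> yx; apply/asboolP; exists y. Qed.
Lemma padic_inv_out : {in [predC padic_unit], padic_inv =1 id}.
Proof. by move=> x /asboolPn nu; apply: xgetPN => y yx; apply: nu; exists y. Qed.

(* With these inverses, ratr : rat -> Zp is the inclusion on the rationals whose
   denominator is prime to p; its value on the others is meaningless. *)
HB.instance Definition _ := GRing.ComNzRing_hasMulInverse.Build Zp
  padic_mulVx padic_unitPl padic_inv_out.

End PadicRing.

Section PadicTopology.
Variables (p : nat) (p_pr : prime p).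
Local Notation Zp := (padic_int p_pr).
Local Open Scope classical_set_scope.

(* The balls x + p^n Z_p form a neighbourhood basis at x. *)
Definition padic_nbhs (x : Zp) : set_system Zp :=
  filter_from [set: nat] (fun n => [set y | residue y n = residue x n]).

Lemma residue_le (x y : Zp) m n : (m <= n)%N ->
  residue x n = residue y n -> residue x m = residue y m.
Proof.
move=> /subnKC <-; elim: (n - m)%N => [|k IHk]; first by rewrite addn0.
by rewrite addnS => xy; apply: IHk; rewrite -(residueP x) xy residueP.
Qed.

HB.instance Definition _ := hasNbhs.Build Zp padic_nbhs.

Lemma padic_nbhs_filter (x : Zp) : ProperFilter (nbhs x).
Proof.
apply: filter_from_proper; last by move=> n _; exists x.
apply: filter_from_filter; first by exists 0%N.
move=> m n _ _; exists (maxn m n) => // y /= xy.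
by split; apply: residue_le xy; rewrite ?leq_maxl ?leq_maxr.
Qed.

Lemma padic_nbhs_singleton (x : Zp) (A : set Zp) : nbhs x A -> A x.
Proof. by case=> n _; apply. Qed.

Lemma padic_nbhs_nbhs (x : Zp) (A : set Zp) : nbhs x A -> nbhs x (nbhs^~ A).
Proof.
case=> n _ xA; exists n => // y /= yx; exists n => // z /= zy.
by apply: xA; rewrite /= zy.
Qed.

HB.instance Definition _ := Nbhs_isNbhsTopological.Build Zp
  padic_nbhs_filter padic_nbhs_singleton padic_nbhs_nbhs.

End PadicTopology.

Section Morita.
Variables (p : nat) (p_pr : prime p).
Local Notation Zp := (padic_int p_pr).
Local Open Scope classical_set_scope.

Definition is_morita_gamma (G : Zp -> Zp) : Prop :=
  continuous G /\
  forall n : nat, (0 < n)%N ->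
    G n%:R = (-1) ^+ n * \prod_(1 <= j < n | ~~ (p %| j)%N) j%:R.

(* The unique such function: see padic_gammaP and padic_gamma_unique below;
   the default value 0 is never used when p is odd. *)
Definition padic_gamma : Zp -> Zp := xget (fun=> 0) is_morita_gamma.

Lemma residue_nat k n : residue (k%:R : Zp) n = (k %% p ^ n)%N.
Proof.
elim: k => [|k IHk]; first by [].
by rewrite -natr1 /= IHk modnDml modnDmr addn1.
Qed.

Lemma wilson_prime_power k : odd p -> (0 < k)%N ->
  \prod_(x : 'Z_(p ^ k) | x \is a GRing.unit) x = -1.
Proof.
move=> p_odd k_gt0; set q := (p ^ k)%N.
have q_gt2 : (2 < q)%N.
  have p_gt2 := odd_prime_gt2 p_odd p_pr.
  by apply: leq_trans p_gt2 _; rewrite -[leqLHS]expn1 leq_exp2l ?prime_gt1.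
have q_gt1 : (1 < q)%N by exact: ltnW.
have sq1 (x : 'Z_q) : x ^+ 2 = 1 -> x = 1 \/ x = -1.
  move=> x2; have e : (x - 1) * (x + 1) = 0 by rewrite -subr_sqr_1 x2 subrr.
  have [a ax] : {a : nat | x = a.+1%:R}.
    case: (posnP (x : nat)) => [x0|xp]; last by exists (x : nat).-1; rewrite prednK ?natr_Zp.
    have xz : x = 0 by exact: val_inj.
    by move/esym/eqP: x2; rewrite xz expr0n oner_eq0.
  move: e; rewrite ax -natr1 addrK !natr1 -natrM => /(congr1 val).
  rewrite /= val_Zp_nat // => /eqP.
  rewrite -/(dvdn q _) => qd.
  have pn2 : coprime p 2 by rewrite prime_coprime // dvdn_prime2 //; case: eqP p_odd => // ->.
  have [pa|pa] := boolP (p %| a)%N.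
    left; have cop : coprime q a.+2.
      rewrite -addn2 /q coprimeXl // prime_coprime // dvdn_addr // -prime_coprime //.
    by move: qd; rewrite Gauss_dvdl // => /eqP qa; rewrite -natr1 [X in X + _]Zp_nat;
      rewrite (_ : inZp a = 0) ?add0r //; apply: val_inj; rewrite /= Zp_cast.
  right; have cop : coprime q a by rewrite /q coprimeXl // prime_coprime.
  move: qd; rewrite Gauss_dvdr // => /eqP qa; apply/eqP; rewrite -subr_eq0 opprK.
  rewrite natr1 Zp_nat; apply/eqP/val_inj; by rewrite /= Zp_cast.
pose inv := fun x : 'Z_q => x^-1.
have m1 : (1 : 'Z_q) != -1.
  rewrite -subr_eq0 opprK -[1+1]/(2%:R); apply/eqP => e.
  by have := val_Zp_nat q_gt1 2; rewrite e modn_small.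
rewrite (bigID (fun x : 'Z_q => x == x^-1)) /= [X in X * _](_ : _ = -1); last first.
  rewrite (bigD1 1) ?unitr1 ?invr1 //= mul1r (bigD1 (-1)) /=; last first.
    by rewrite unitrN1 invrN1 eqxx eq_sym m1.
  rewrite big1 ?mulr1 // => x /andP[/andP[/andP[ux /eqP xx] x1] xm1].
  have /sq1 [xE|xE] : x ^+ 2 = 1 by rewrite expr2 {2}xx divrr.
    by rewrite xE eqxx in x1.
  by rewrite xE eqxx in xm1.
rewrite (bigID (fun x : 'Z_q => x < x^-1)%N) /=.
rewrite [X in _ * (_ * X)](reindex_inj (@invr_inj _)) /=.
rewrite [X in _ * (_ * X)](eq_bigl (fun x : 'Z_q =>
  (x \is a GRing.unit) && (x != x^-1) && (x < x^-1)%N)); last first.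
  move=> x; rewrite unitrV invrK [_^-1 == x]eq_sym -leqNgt; case: eqP => [|/eqP xx].
    by rewrite andbF.
  by rewrite ltn_neqAle (inj_eq val_inj) xx.
by rewrite -big_split /= big1 ?mulr1 // => x /andP[/andP[ux _] _]; rewrite divrr.
Qed.

Lemma prod_window k a : odd p ->
  (p ^ k %| (\prod_(a <= j < a + p ^ k | ~~ (p %| j)) j).+1)%N.
Proof.
move=> p_odd; case: (posnP k) => [-> // | k_gt0]; set q := (p ^ k)%N.
have q_gt1 : (1 < q)%N by rewrite -(expn0 p) ltn_exp2l ?prime_gt1.
have pq : (p %| q)%N by rewrite dvdn_exp.
pose f (j : nat) : 'Z_q := if ~~ (p %| j)%N then j%:R else 1.
suff fN1 : \prod_(a <= j < a + q) f j = -1.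
  have : (\prod_(a <= j < a + q | ~~ (p %| j)%N) j)%N.+1%:R = 0 :> 'Z_q.
    by rewrite -natr1 natr_prod big_mkcond /= fN1 addNr.
  by move/(congr1 val); rewrite /= val_Zp_nat // => /eqP.
elim: a => [|a IHa].
  rewrite add0n -(wilson_prime_power p_odd k_gt0) -big_mkcond /=.
  rewrite -/q big_mkord.
  have castE n : n = q -> \prod_(i < q | ~~ (p %| i)%N) (i%:R : 'Z_q) =
      \prod_(i < n | ~~ (p %| i)%N) i%:R by move->.
  rewrite (castE _ (Zp_cast q_gt1)); apply: eq_big => [x|x _]; last exact: natr_Zp.
  by rewrite -{2}[x]natr_Zp unitZpE // coprime_pexpl // prime_coprime.
have fq : f (a + q)%N = f a.
  by rewrite /f dvdn_addl // natrD -[X in _ + X]natr_Zp val_Zp_nat // modnn addr0.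
rewrite -IHa [in RHS]big_ltn ?addSn; last by rewrite -[leqLHS]addn1 leq_add2l ltnW.
rewrite big_nat_recr ?leq_addr ?ltnS /=; last by rewrite -[leqLHS]addn1 leq_add2l ltnW.
by rewrite fq mulrC.
Qed.

Lemma residueDp x y k : residue (x + (p ^ k)%:R * y : Zp) k = residue x k.
Proof. by rewrite /= residue_nat modnn mul0n mod0n addn0 residue_mod. Qed.

Let morita (n : nat) : Zp := (-1) ^+ n * \prod_(1 <= j < n | ~~ (p %| j)%N) j%:R.

Lemma moritaE n : morita n = (-1) ^+ n * (\prod_(0 <= j < n | ~~ (p %| j)%N) j)%N%:R.
Proof.
rewrite /morita natr_prod; case: n => [|n]; first by rewrite !big_geq.
by rewrite [in RHS]big_ltn_cond // dvdn0.
Qed.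

Lemma moritaDp a k : odd p -> residue (morita (a + p ^ k)) k = residue (morita a) k.
Proof.
move=> p_odd; have /dvdnP[c cE] := prod_window k a p_odd.
have -> : morita (a + p ^ k)%N = morita a + (p ^ k)%:R * (- morita a * c%:R).
  rewrite !moritaE (@big_cat_nat _ _ _ a) ?leq_addr //= natrM exprD.
  rewrite -[in (-1) ^+ (p ^ k)]signr_odd oddX p_odd orbT expr1.
  have -> : (\prod_(a <= j < a + p ^ k | ~~ (p %| j)%N) j)%N%:R = c%:R * (p ^ k)%:R - 1 :> Zp.
    by rewrite -natrM -cE -natr1 addrK.
  set e := (-1) ^+ a; set P := _%:R; set q := (p ^ k)%:R.
  by rewrite mulrN1 mulNr !mulrA mulrBr mulr1 opprB [q * _]mulrC !mulNr !mulrA [in LHS]mulrAC.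
exact: residueDp.
Qed.

Lemma morita_modp n k : odd p -> residue (morita (n %% p ^ k)) k = residue (morita n) k.
Proof.
move=> p_odd; rewrite [in RHS](divn_eq n (p ^ k)) addnC.
by elim: (n %/ p ^ k)%N => [|c IHc]; rewrite ?addn0 // mulSnr addnA moritaDp.
Qed.

Lemma padic_gamma_unique G H :
  is_morita_gamma (G : Zp -> Zp) -> is_morita_gamma (H : Zp -> Zp) -> G = H.
Proof.
move=> [Gc Gn] [Hc Hn]; apply: funext => x; apply: padic_intP => k.
have near (F : Zp -> Zp) : continuous F ->
    exists m, forall y, residue y m = residue x m -> residue (F y) k = residue (F x) k.
  move=> /(_ x [set y | residue y k = residue (F x) k]).
  by case=> [|m _ xm]; [exists k | exists m].
have [m Gm] := near G Gc; have [l Hl] := near H Hc.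
set j := maxn m l; set n := (residue x j + p ^ j)%N.
have n_gt0 : (0 < n)%N by rewrite addn_gt0 (expp_gt0 p_pr) orbT.
have nx : residue (n%:R : Zp) j = residue x j by rewrite residue_nat modnDr residue_mod.
rewrite -(Gm n%:R) ?Gn -?Hn ?(Hl n%:R) //; first exact: residue_le (leq_maxr _ _) nx.
exact: residue_le (leq_maxl _ _) nx.
Qed.

Lemma padic_gammaP : odd p -> is_morita_gamma padic_gamma.
Proof.
move=> p_odd; apply: xgetPex.
have mk x n : residue (morita (residue x n.+1)) n.+1 =
    residue (morita (residue (x : Zp) n)) n %[mod p ^ n].
  by rewrite residue_modS -(residueP x n) morita_modp.
exists (fun x => padic_mk p_pr (mk x)); split=> [x A [n _ xA]|n n_gt0].
  by exists n => // y yx; apply: xA; rewrite /= yx.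
apply: padic_intP => k; rewrite -/(morita n) -[RHS]morita_modp // -residue_nat.
by rewrite -[RHS]residue_mod.
Qed.

End Morita.

(* Main.v *)
From HB Require Import structures.
Require Import Defs.
From mathcomp Require Import classical_sets.
From mathcomp Require Import all_boot all_order all_algebra all_field.
From mathcomp Require Import ring lra zify.

Import Order.TTheory GRing.Theory Num.Theory.
Local Open Scope ring_scope.

Set Implicit Arguments.
Unset Strict Implicit.
Unset Printing Implicit Defensive.

(* For x in {p/2, -p/2, -p/6} the series
     F(x) = sum_k (1/2+3x)_k (1/2+x)_k (1/2-x)_k / (k! (1+2x)_k (1+x)_k) (-1/8)^k
   terminates within its first (p+1)/2 terms, and a WZ recurrence, which relates F(x+2)
   to F(x), evaluates it there as the square of a quotient of rising factorials. Modulo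
   p^3 both F(pt), truncated, and
     - (-1)^m 2^(3(p-1)t) (G(1+pt) G(1/4+pt/2) G(1/4-3pt/2))^2,   p = 4m+1,
   where G is the p-adic Gamma function and 2^(p-1) = (1+pd)^2, are quadratic polynomials
   in t. They agree at t = 1/2, -1/2, -1/6 by the functional equation and the reflection
   formula, hence at t = 0, where the congruence is the claim. *)

(** At each of the three points one upper factor vanishes at k = (p-1)/2: [2^-1 - x + k] at p/2,
    [2^-1 + x + k] at -p/2, [2^-1 + 3 * x + k] at -p/6. The recurrence moves x by 2, and p = 4m+1
    places the points at 1/2 + 2m, -1/2 - 2m and, according to p modulo 3, -1/6 - 2j or -5/6 - 2j,
    so each is reached from a sum of at most three terms. The recurrence cannot be run modulo p^3:
    on the way to p/2 the factor [1 + 2 * x + 3] at x = p/2 - 2 is p itself. The evaluations are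
    therefore proved over an ordered field, and only the final identities, whose denominators are
    prime to p, are reduced. In Z/p^3 every element is the image of a natural number, so the
    statements about G become inductions on natural numbers. G occurs only squared, which hides the
    signs in its functional equation and reflection formula; the one sign that matters is G(1/2)^2 =
    -1, where p = 1 mod 4 enters again. *)

Section Term.
Variable U : unitRingType.

Definition rising (a : U) (k : nat) : U := \prod_(i < k) (a + i%:R).

Definition term_ratio (x y : U) : U :=
  ((2^-1 + 3 * x + y) * (2^-1 + x + y) * (2^-1 - x + y) * - 8^-1)
  / ((1 + y) * (1 + 2 * x + y) * (1 + x + y)).

(** A product of ratios makes sense in any unit ring, so the same definition serves over the
    rationals and in Z/p^3. *)
Definition term (x : U) (k : nat) : U := \prod_(i < k) term_ratio x i%:R.

Lemma risingS a k : rising a k.+1 = rising a k * (a + k%:R).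
Proof. by rewrite /rising big_ord_recr. Qed.

Lemma rising0 a : rising a 0 = 1.
Proof. by rewrite /rising big_ord0. Qed.

Lemma termS x k : term x k.+1 = term x k * term_ratio x k%:R.
Proof. by rewrite /term big_ord_recr. Qed.

Lemma term0 x : term x 0 = 1.
Proof. by rewrite /term big_ord0. Qed.

End Term.

Lemma rising_add (U : unitRingType) (a : U) j k :
  rising a (j + k) = rising a j * rising (a + j%:R) k.
Proof.
elim: k => [|k IH]; first by rewrite addn0 rising0 mulr1.
by rewrite addnS !risingS IH natrD addrA mulrA.
Qed.

(** * The WZ recurrence from x to x + 2 *)

Section WZ.
Variable F : numFieldType.

(* [term (x + 2) k] and [term x k] are multiples of the common sequence [wz_base x k],
   with polynomial factors [shift_num x k / shift_num x 0] and [base_num x k / base_num x 0]. *)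
Definition shift_num (x y : F) :=
  let a := 2^-1 + 3 * x + y in let b := 2^-1 + x + y in
  a * (a + 1) * (a + 2) * (a + 3) * (a + 4) * (a + 5) * (b * (b + 1)).

Definition base_num (x y : F) :=
  let d := 1 + 2 * x + y in let e := 1 + x + y in let c := - (3 / 2) - x + y in
  d * (d + 1) * (d + 2) * (d + 3) * (e * (e + 1)) * (c * (c + 1)).

(* The polynomial solution of Gosper's equation [gosper_identity], found by linear algebra.
   Its coefficients are split in base 1000 because ring numerals are unary. *)
Definition gosper_cert (x k : F) : F :=
  - ((29 * 1000 + 799) / 4) - (161 * 1000 + 259) / 2 * x - (330 * 1000 + 699) * x ^+ 2
    - (689 * 1000 + 854) * x ^+ 3 - (807 * 1000 + 892) * x ^+ 4
    - (539 * 1000 + 144) * x ^+ 5 - (191 * 1000 + 888) * x ^+ 6 - (28 * 1000 + 320) * x ^+ 7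
  - k * ((38 * 1000 + 721) / 2 + (170 * 1000 + 30) * x + (550 * 1000 + 518) * x ^+ 2
         + (880 * 1000 + 656) * x ^+ 3 + (751 * 1000 + 416) * x ^+ 4
         + (328 * 1000 + 928) * x ^+ 5 + (58 * 1000 + 272) * x ^+ 6)
  - k ^+ 2 * ((15 * 1000 + 734) + (104 * 1000 + 732) * x + (247 * 1000 + 776) * x ^+ 2
              + (273 * 1000 + 856) * x ^+ 3 + (145 * 1000 + 696) * x ^+ 4
              + (30 * 1000 + 528) * x ^+ 5)
  + k ^+ 3 * (- (3 * 1000 + 828) - (8 * 1000 + 528) * x + (2 * 1000 + 976) * x ^+ 2
              + (15 * 1000 + 40) * x ^+ 3 + (7 * 1000 + 104) * x ^+ 4)
  + k ^+ 4 * (500 + (9 * 1000 + 480) * x + (18 * 1000 + 736) * x ^+ 2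
              + (9 * 1000 + 696) * x ^+ 3)
  + k ^+ 5 * (216 + (1 * 1000 + 952) * x + (2 * 1000 + 16) * x ^+ 2).

Definition gosper_num (x y : F) :=
  (2^-1 + 3 * x + y) * (2^-1 + x + y) * (- (3 / 2) - x + y) * - 8^-1.

(** Of the parameters of [term x] and [term (x + 2)], this ratio takes the smaller upper one and the
    larger lower one each time, so that both terms are polynomial multiples of the product. *)
Definition wz_base_ratio (x y : F) : F :=
  gosper_num x y / ((1 + y) * (5 + 2 * x + y) * (3 + x + y)).

Definition wz_base (x : F) (k : nat) : F := \prod_(i < k) wz_base_ratio x i%:R.

(** Multiplied by [wz_base x k], the right side is U(k+1) - U(k) with U(k) = [wz_base x k * k * (4 +
    2 * x + k) * (2 + x + k) * gosper_cert x k], and U(0) = 0. *)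
Lemma gosper_identity (x k : F) :
  (6 * x + 7) * (6 * x + 11) * shift_num x k - 64 * (1 + 6 * x) * (5 + 6 * x) * base_num x k =
  gosper_num x k * gosper_cert x (k + 1) - k * (4 + 2 * x + k) * (2 + x + k) * gosper_cert x k.
Proof. by rewrite /shift_num /base_num /gosper_cert /gosper_num; field. Qed.

Lemma wz_baseS x k : wz_base x k.+1 = wz_base x k * wz_base_ratio x k%:R.
Proof. by rewrite /wz_base big_ord_recr. Qed.

Section Recurrence.
Variables (x : F) (K : nat).
Hypothesis dK : forall j, (j < K + 4)%N -> 1 + 2 * x + j%:R != 0.
Hypothesis eK : forall j, (j < K + 4)%N -> 1 + x + j%:R != 0.

Lemma denominators_neq0 k : (k < K)%N ->
  [/\ 1 + k%:R != 0 :> F, 1 + 2 * x + k%:R != 0, 1 + x + k%:R != 0,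
      5 + 2 * x + k%:R != 0 & 3 + x + k%:R != 0].
Proof.
move=> kK; split.
- by rewrite addrC natr1 pnatr_eq0.
- by apply: dK; lia.
- by apply: eK; lia.
- have: 1 + 2 * x + (k + 4)%:R != 0 by apply: dK; lia.
  rewrite natrD.
  by congr (_ != 0); ring.
have: 1 + x + (k + 2)%:R != 0 by apply: eK; lia.
rewrite natrD.
by congr (_ != 0); ring.
Qed.

Lemma term_wz_base k : (k <= K)%N -> term x k * base_num x 0 = wz_base x k * base_num x k%:R.
Proof.
elim: k => [|k IH] kK; first by rewrite term0 /wz_base big_ord0.
have [h1 h2 h3 h4 h5] := denominators_neq0 kK.
rewrite termS wz_baseS mulrAC IH ?(ltnW kK) // -!mulrA; congr (_ * _).
rewrite -[k.+1%:R]natr1; move: (k%:R) h1 h2 h3 h4 h5 => y h1 h2 h3 h4 h5.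
by rewrite /term_ratio /wz_base_ratio /gosper_num /base_num; field; rewrite h1 h2 h3 h4 h5.
Qed.

Lemma term_shift_wz_base k : (k <= K)%N -> term (x + 2) k * shift_num x 0
  = wz_base x k * shift_num x k%:R.
Proof.
elim: k => [|k IH] kK; first by rewrite term0 /wz_base big_ord0.
have [h1 h2 h3 h4 h5] := denominators_neq0 kK.
rewrite termS wz_baseS mulrAC IH ?(ltnW kK) // -!mulrA; congr (_ * _).
rewrite -[k.+1%:R]natr1; move: (k%:R) h1 h2 h3 h4 h5 => y h1 h2 h3 h4 h5.
by rewrite /term_ratio /wz_base_ratio /gosper_num /shift_num; field; rewrite h1 h4 h5.
Qed.

(** The sum telescopes to U(k+1), written with the denominator of the last ratio cancelled so that a
    zero of [gosper_num] is visible in it. *)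
Lemma wz_telescope k : (k <= K)%N ->
  \sum_(i < k.+1) ((6 * x + 7) * (6 * x + 11) * (term (x + 2) i * shift_num x 0)
    - 64 * (1 + 6 * x) * (5 + 6 * x) * (term x i * base_num x 0)) =
  wz_base x k * gosper_num x k%:R * gosper_cert x (k%:R + 1).
Proof.
have step i : (i <= K)%N ->
    (6 * x + 7) * (6 * x + 11) * (term (x + 2) i * shift_num x 0)
    - 64 * (1 + 6 * x) * (5 + 6 * x) * (term x i * base_num x 0) =
    wz_base x i * (gosper_num x i%:R * gosper_cert x (i%:R + 1)
      - i%:R * (4 + 2 * x + i%:R) * (2 + x + i%:R) * gosper_cert x i%:R).
  move=> iK; rewrite -gosper_identity term_wz_base // term_shift_wz_base //; ring.
elim: k => [|k IH] kK.
  by rewrite big_ord_recr big_ord0 step //= /wz_base big_ord0; ring.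
rewrite big_ord_recr /= IH ?(ltnW kK) // step // wz_baseS /wz_base_ratio.
have [h1 _ _ h4 h5] := denominators_neq0 kK.
rewrite -[k.+1%:R]natr1; move: (k%:R) h1 h4 h5 (wz_base x k) (gosper_cert x) => y h1 h4 h5 u G.
move: (gosper_num x) => N.
by field; rewrite h1 h4 h5.
Qed.

Lemma wz_recurrence :
  shift_num x 0 != 0 -> (exists2 i, (i <= K)%N & gosper_num x i%:R = 0) ->
  \sum_(i < K.+1) term (x + 2) i =
  (128 * (1 + x) * (2 + x) / (3 * (6 * x + 7) * (6 * x + 11))) ^+ 2
  * \sum_(i < K.+1) term x i.
Proof.
move=> P0 [i iK iN].
have wz := wz_telescope (leqnn K).
(* A zero of [gosper_num] before [K] is a factor of [wz_base x K]; a zero at [K] is the other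
   factor. *)
have w0 : wz_base x K * gosper_num x K%:R = 0.
  move: iK; rewrite leq_eqVlt => /orP[/eqP <-|iK]; first by rewrite iN mulr0.
  by rewrite /wz_base (bigD1 (Ordinal iK)) //= /wz_base_ratio iN !mul0r.
move: wz; rewrite w0 mul0r big_split /= sumrN -!mulr_sumr -!mulr_suml.
move: (\sum_(i < _) term (x + 2) i) (\sum_(i < _) term x i) => S' S /eqP.
rewrite subr_eq0 => /eqP e.
(* These factorizations show why the recurrence has a perfect square as its coefficient: all factors
   that are not squared cancel or pair up with the coefficients of the telescoped sum. *)
have Q0 : base_num x 0 = (2 * x + 1) ^+ 2 * (2 * x + 3) ^+ 2 * (x + 1) ^+ 2 * (x + 2) ^+ 2.
  by rewrite /base_num; field.
have P0E : shift_num x 0 = 9 / 256 * (2 * x + 1) ^+ 2 * (2 * x + 3) ^+ 2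
    * ((1 + 6 * x) * (5 + 6 * x) * (6 * x + 7) * (6 * x + 11)).
  by rewrite /shift_num; field.
have : [&& 2 * x + 1 != 0, 2 * x + 3 != 0, 1 + 6 * x != 0, 5 + 6 * x != 0,
    6 * x + 7 != 0 & 6 * x + 11 != 0].
  have nz y : (y = 0 -> shift_num x 0 = 0) -> y != 0.
    by move=> yP; apply: contraNneq P0 => /yP ->.
  by do !(apply/andP; split); apply: nz => z0;
    rewrite P0E z0 ?expr0n ?(mulr0, mul0r).
case/and5P=> h1 h2 h3 h4 /andP[h5 h6].
move: e; rewrite P0E Q0 => e.
set c := (2 * x + 1) ^+ 2 * (2 * x + 3) ^+ 2 * ((1 + 6 * x) * (5 + 6 * x)) in e.
have c0 : c != 0 by rewrite /c !mulf_neq0 ?expf_neq0.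
apply: (mulfI c0); apply: (mulfI (mulf_neq0 (expf_neq0 2 h5) (expf_neq0 2 h6))).
apply: (@mulfI _ (9 / 256)); first by rewrite mulf_neq0 ?invr_eq0 ?pnatr_eq0.
transitivity ((6 * x + 7) * (6 * x + 11) * (S' * (9 / 256 * (2 * x + 1) ^+ 2 * (2 * x + 3) ^+ 2
    * ((1 + 6 * x) * (5 + 6 * x) * (6 * x + 7) * (6 * x + 11))))).
  by rewrite /c; field.
by rewrite e /c; field; rewrite h5 h6.
Qed.

End Recurrence.
End WZ.

(** * Closed forms of the terminating sums over an ordered field *)

Section ClosedForms.
Variable F : realFieldType.

Definition wz_factor (x : F) :=
  128 * (1 + x) * (2 + x) / (3 * (6 * x + 7) * (6 * x + 11)).

Lemma rising_gt0 (a : F) k : 0 < a -> 0 < rising a k.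
Proof.
by move=> a0; rewrite prodr_gt0 // => i _; rewrite ltr_wpDr ?ler0n.
Qed.

Lemma shift_num_neq0 (x : F) : (forall i, (i < 6)%N -> 2^-1 + 3 * x + i%:R != 0) ->
  2^-1 + x != 0 -> 2^-1 + x + 1 != 0 -> shift_num x 0 != 0.
Proof.
move=> h b0 b1; have := (h 0 isT, h 1 isT, h 2 isT, h 3 isT, h 4 isT, h 5 isT)%N.
by case=> -[[[[h0 h1] h2] h3] h4] h5; rewrite /shift_num !mulf_neq0 ?addr0 // -[_ + _]addr0.
Qed.

Lemma sum_term_widen (x : F) n k :
  term_ratio x n%:R = 0 -> (n <= k)%N ->
  \sum_(i < k.+1) term x i = \sum_(i < n.+1) term x i.
Proof.
move=> xn nk; rewrite -(subnKC nk) -addSn big_split_ord /= [X in _ + X]big1 ?addr0 // => i _.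
have ni : (n < n.+1 + i)%N by rewrite addSn ltnS leq_addr.
by rewrite /term (bigD1 (Ordinal ni)) //= xn mul0r.
Qed.

Lemma term_ratio_eq0 (x y : F) :
  (2^-1 + 3 * x + y) * (2^-1 + x + y) * (2^-1 - x + y) = 0 -> term_ratio x y = 0.
Proof. by rewrite /term_ratio => ->; rewrite !mul0r. Qed.

(** The factor [2^-1 - x + k] ends the series at k = 2j. The recurrence is used upwards from x =
    1/2, where the sum is the single term 1. *)
Lemma sum_term_half_pos j :
  \sum_(i < (2 * j).+1) term (2^-1 + (2 * j)%:R : F) i =
  (8 ^+ j * rising 2^-1 j / rising (3 / 2 + (2 * j)%:R) j) ^+ 2.
Proof.
elim: j => [|j IH].
  by rewrite big_ord_recr big_ord0 /= term0 !rising0 expr0 !mulr1 divr1 expr1n add0r.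
have xE : 2^-1 + (2 * j.+1)%:R = 2^-1 + (2 * j)%:R + 2 :> F.
  by rewrite mulnS natrD; ring.
have j0 : 0 <= j%:R :> F by rewrite ler0n.
set x : F := 2^-1 + (2 * j)%:R; have xE' : x = 2^-1 + 2 * j%:R by rewrite /x natrM.
have hd i : (i < 2 * j.+1 + 4)%N -> 1 + 2 * x + i%:R != 0.
  by move=> _; apply: lt0r_neq0; have := ler0n F i; lra.
have he i : (i < 2 * j.+1 + 4)%N -> 1 + x + i%:R != 0.
  by move=> _; apply: lt0r_neq0; have := ler0n F i; lra.
have hP : shift_num x 0 != 0.
  by apply: shift_num_neq0 => [i _||]; apply: lt0r_neq0; try have := ler0n F i; lra.
(* The zero belongs to the upper parameter [- (3 / 2) - x] of the shifted series, so the recurrence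
   is summed up to 2j + 2; the sum at x itself already stops at 2j. *)
have hN : exists2 i, (i <= 2 * j.+1)%N & gosper_num x i%:R = 0.
  exists (2 * j.+1)%N => //; rewrite /gosper_num mulnS natrD natrM xE'.
  by rewrite (_ : - (3 / 2) - _ + _ = 0) ?mulr0 ?mul0r //; field.
have hr : term_ratio x (2 * j)%:R = 0.
  by apply: term_ratio_eq0; rewrite (_ : 2^-1 - _ + _ = 0) ?mulr0 // /x; ring.
have le : (2 * j <= 2 * j.+1)%N by rewrite leq_mul2l leqnSn orbT.
rewrite xE (wz_recurrence hd he hP hN) (sum_term_widen hr le).
rewrite IH -exprMn -/(wz_factor _); congr (_ ^+ 2).
set y : F := 3 / 2 + (2 * j)%:R; have yE : y = 3 / 2 + 2 * j%:R by rewrite /y natrM.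
have y0 : 0 < y by lra.
have -> : 3 / 2 + (2 * j.+1)%:R = y + 2%:R by rewrite /y mulnS natrD; ring.
have r1 : rising y j != 0 by rewrite lt0r_neq0 ?rising_gt0.
(* From j to j + 1 both the starting point and the length of the rising factorial change;
   [rising y j.+3] contains both versions. *)
have := rising_add y 2 j.+1; rewrite (_ : 2 + j.+1 = j.+3)%N // 2!(risingS y) risingS.
rewrite (risingS y 1) (risingS y 0) rising0 mul1r addr0 -[j.+2%:R]natr1 -[j.+1%:R]natr1.
move: (rising (y + 2%:R) j.+1) (rising y j) r1 => A B B0 e.
have {e} -> : A = B * (y + j%:R) * (y + (j%:R + 1)) * (y + (j%:R + 1 + 1)) / (y * (y + 1)).
  by rewrite e; field; do ?[apply/andP; split]; apply: lt0r_neq0; lra.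
rewrite risingS exprS /wz_factor xE' yE; field.
by rewrite B0 /=; do ?[apply/andP; split]; apply: lt0r_neq0; lra.
Qed.

(** For negative x the known sum is the one at [x + 2], so the recurrence is solved for the sum at x
    by cancelling the square of its nonzero factor. *)
Lemma wz_descent (x : F) n k (c : F) :
    (forall i, (i < k + 4)%N -> 1 + 2 * x + i%:R != 0) ->
    (forall i, (i < k + 4)%N -> 1 + x + i%:R != 0) ->
    shift_num x 0 != 0 -> (2^-1 + 3 * x + k%:R) * (2^-1 + x + k%:R) = 0 ->
    term_ratio (x + 2) n%:R = 0 -> (n <= k)%N -> wz_factor x != 0 ->
    \sum_(i < n.+1) term (x + 2) i = (wz_factor x * c) ^+ 2 ->
  \sum_(i < k.+1) term x i = c ^+ 2.
Proof.
move=> hd he hP hk hn nk f0; rewrite -(sum_term_widen hn nk) (wz_recurrence hd he hP).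
  rewrite -/(wz_factor x); move: (wz_factor x) f0 => f f0.
  by rewrite exprMn => /(mulfI (expf_neq0 2 f0)).
by exists k => //; rewrite /gosper_num hk !mul0r.
Qed.

(** The induction starts at x = -5/2: descending to it from -1/2 would meet the zero of
    [1 + 2 * x + i] at i = 4. From there on the zero lies beyond the indices that the recurrence
    uses. *)
Lemma sum_term_half_neg j :
  \sum_(i < (2 * j.+1).+1) term (- 2^-1 - (2 * j.+1)%:R : F) i =
  (rising j.+2%:R (2 * j.+1) / (8 ^+ j.+1 * rising 2^-1 (2 * j.+1))) ^+ 2.
Proof.
elim: j => [|j IH].
  rewrite !big_ord_recr big_ord0 /= muln1 !(termS, term0, risingS, rising0) /term_ratio expr1.
  by field.
have j0 : 0 <= j%:R :> F by rewrite ler0n.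
set x : F := - 2^-1 - (2 * j.+2)%:R.
have xE : x = - (9 / 2) - 2 * j%:R by rewrite /x natrM -addn2 natrD; field.
have xE2 : - 2^-1 - (2 * j.+1)%:R = x + 2 by rewrite /x !natrM -addn2 -addn1 !natrD; field.
have kE : (2 * j.+2)%:R = 4 + 2 * j%:R :> F by rewrite natrM -addn2 natrD; field.
have nE : (2 * j.+1)%:R = 2 + 2 * j%:R :> F by rewrite natrM -addn1 natrD; field.
rewrite xE2 in IH; apply: (@wz_descent x (2 * j.+1)).
- move=> i ilt; apply: ltr0_neq0; rewrite xE.
  have : i%:R < (2 * j.+2 + 4)%:R :> F by rewrite ltr_nat.
  by rewrite natrD kE; lra.
- move=> i _; apply/eqP => h.
  have /eqP : (2 * i)%:R = (4 * j + 7)%:R :> F by rewrite natrM natrD natrM; lra.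
  by rewrite eqr_nat; lia.
- by apply: shift_num_neq0 => [i i6||]; apply: ltr0_neq0;
  try (have : i%:R <= 5%:R :> F by rewrite ler_nat); lra.
- by rewrite kE xE (_ : 2^-1 + (- (9 / 2) - _) + _ = 0) ?mulr0 //; field.
- by apply: term_ratio_eq0;
rewrite nE xE (_ : 2^-1 + (- (9 / 2) - _ + 2) + _ = 0) ?mulr0 ?mul0r //; field.
- by rewrite leq_mul2l leqnSn orbT.
- rewrite /wz_factor xE !(mulf_neq0, invr_neq0) ?pnatr_eq0 //; try by apply: ltr0_neq0; lra.
rewrite IH; congr (_ ^+ 2).
have := rising_add (j.+2%:R : F) 1 (2 * j.+2).
have -> : (2 * j.+2 = (2 * j.+1).+2)%N by lia.
move: (2 * j.+1)%N nE => n nE; rewrite natr1 risingS rising0 mul1r addr0 add1n.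
have r1 : rising 2^-1 n != 0 :> F by rewrite lt0r_neq0 // rising_gt0 // invr_gt0 ltr0n.
rewrite !(risingS j.+2%:R) !(risingS 2^-1) (exprS _ j.+1).
move: (rising j.+3%:R _) (rising j.+2%:R _) => A B.
rewrite -![n.+2%:R]natr1 -![n.+1%:R]natr1 -[j.+2%:R]natr1 -[j.+1%:R]natr1 nE xE /wz_factor.
have p0 : 8 ^+ j.+1 != 0 :> F by rewrite expf_neq0 ?pnatr_eq0.
move: (rising 2^-1 _) (8 ^+ j.+1) r1 p0 => C D C0 D0 h.
have j2 : j%:R + 1 + 1 != 0 :> F by apply: lt0r_neq0; lra.
have {h} -> := canRL (mulKf j2) (esym h).
by field; rewrite C0 D0 /=; do ?[apply/andP; split]; first [by apply: lt0r_neq0;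
  lra | by apply: ltr0_neq0; lra].
Qed.

(** This is x = -p/6 for p = 12j + 1, where [2^-1 + 3 * x + k] vanishes at k = 6j; a step of 2 in x
    moves that index by 6. The next lemma is the case p = 12j + 5. *)
Lemma sum_term_sixth_1 j :
  \sum_(i < (6 * j).+1) term (- 6^-1 - (2 * j)%:R : F) i =
  (rising 2^-1 (3 * j) / (2 ^+ (3 * j) * (rising 6^-1 (2 * j) * rising (5 / 6) j))) ^+ 2.
Proof.
elim: j => [|j IH].
  by rewrite big_ord_recr big_ord0 /= !(term0, rising0) expr0; field.
have j0 : 0 <= j%:R :> F by rewrite ler0n.
set x : F := - 6^-1 - (2 * j.+1)%:R.
have xE : x = - (13 / 6) - 2 * j%:R by rewrite /x natrM -addn1 natrD; field.
have xE2 : - 6^-1 - (2 * j)%:R = x + 2 by rewrite /x !natrM -addn1 !natrD; field.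
have kE : (6 * j.+1)%:R = 6 + 6 * j%:R :> F by rewrite natrM -addn1 natrD; field.
rewrite xE2 in IH; apply: (@wz_descent x (6 * j)).
- move=> i _; apply/eqP => h.
  have /eqP : (3 * i)%:R = (12 * j + 10)%:R :> F by rewrite natrM natrD natrM; lra.
  by rewrite eqr_nat; lia.
- move=> i _; apply/eqP => h.
  have /eqP : (6 * i)%:R = (12 * j + 7)%:R :> F by rewrite natrM natrD natrM; lra.
  by rewrite eqr_nat; lia.
- by apply: shift_num_neq0 => [i i6||]; apply: ltr0_neq0;
  try (have : i%:R <= 5%:R :> F by rewrite ler_nat); lra.
- by rewrite kE xE (_ : 2^-1 + 3 * (- (13 / 6) - _) + _ = 0) ?mul0r //; field.
- by apply: term_ratio_eq0;
rewrite natrM xE (_ : 2^-1 + 3 * (- (13 / 6) - _ + 2) + _ = 0) ?mul0r //; field.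
- by rewrite leq_mul2l leqnSn orbT.
- rewrite /wz_factor xE !(mulf_neq0, invr_neq0) ?pnatr_eq0 //; try by apply: ltr0_neq0; lra.
rewrite IH; congr (_ ^+ 2).
have -> : (3 * j.+1 = (3 * j).+3)%N by lia.
have -> : (2 * j.+1 = (2 * j).+2)%N by lia.
have nE : (3 * j)%:R = 3 * j%:R :> F by rewrite natrM.
have lE : (2 * j)%:R = 2 * j%:R :> F by rewrite natrM.
move: (3 * j)%N (2 * j)%N nE lE => n l nE lE.
have p0 : 2 ^+ n != 0 :> F by rewrite expf_neq0 ?pnatr_eq0.
have r1 : rising 6^-1 l != 0 :> F by rewrite lt0r_neq0 // rising_gt0 // invr_gt0 ltr0n.
have r2 : rising (5 / 6) j != 0 :> F by rewrite lt0r_neq0 // rising_gt0 // divr_gt0 ?ltr0n.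
rewrite !risingS !exprS -![n.+2%:R]natr1 -![n.+1%:R]natr1 -[l.+1%:R]natr1 nE lE xE /wz_factor.
move: (rising 2^-1 _) (rising 6^-1 _) (rising (5 / 6) _) (2 ^+ n) r1 r2 p0 => A B C D B0 C0 D0.
by field; rewrite B0 C0 D0 /=; do ?[apply/andP; split];
  first [by apply: lt0r_neq0; lra | by apply: ltr0_neq0; lra].
Qed.

Lemma sum_term_sixth_5 j :
  \sum_(i < (6 * j + 2).+1) term (- (5 / 6) - (2 * j)%:R : F) i =
  (rising 2^-1 (3 * j + 1)
   / (2 ^+ (3 * j + 1) * (rising (5 / 6) (2 * j) * rising 6^-1 (j + 1)))) ^+ 2.
Proof.
rewrite !addn1 addn2; elim: j => [|j IH].
  rewrite !big_ord_recr big_ord0 /= !(termS, term0, risingS, rising0) /term_ratio expr1.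
  by field.
have j0 : 0 <= j%:R :> F by rewrite ler0n.
set x : F := - (5 / 6) - (2 * j.+1)%:R.
have xE : x = - (17 / 6) - 2 * j%:R by rewrite /x natrM -addn1 natrD; field.
have xE2 : - (5 / 6) - (2 * j)%:R = x + 2 by rewrite /x !natrM -addn1 !natrD; field.
have kE : (6 * j.+1).+2%:R = 8 + 6 * j%:R :> F by rewrite -addn2 natrD natrM -addn1 natrD;
  field.
have lE : (6 * j).+2%:R = 2 + 6 * j%:R :> F by rewrite -addn2 natrD natrM; field.
rewrite xE2 in IH; apply: (@wz_descent x (6 * j).+2).
- move=> i _; apply/eqP => h.
  have /eqP : (3 * i)%:R = (12 * j + 14)%:R :> F by rewrite natrM natrD natrM; lra.
  by rewrite eqr_nat; lia.
- move=> i _; apply/eqP => h.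
  have /eqP : (6 * i)%:R = (12 * j + 11)%:R :> F by rewrite natrM natrD natrM; lra.
  by rewrite eqr_nat; lia.
- by apply: shift_num_neq0 => [i i6||]; apply: ltr0_neq0;
  try (have : i%:R <= 5%:R :> F by rewrite ler_nat); lra.
- by rewrite kE xE (_ : 2^-1 + 3 * (- (17 / 6) - _) + _ = 0) ?mul0r //; field.
- by apply: term_ratio_eq0;
rewrite lE xE (_ : 2^-1 + 3 * (- (17 / 6) - _ + 2) + _ = 0) ?mul0r //; field.
- by lia.
- rewrite /wz_factor xE !(mulf_neq0, invr_neq0) ?pnatr_eq0 //; try by apply: ltr0_neq0; lra.
rewrite IH; congr (_ ^+ 2).
have -> : (3 * j.+1 = (3 * j).+3)%N by lia.
have -> : (2 * j.+1 = (2 * j).+2)%N by lia.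
have nE : (3 * j)%:R = 3 * j%:R :> F by rewrite natrM.
move: (3 * j)%N nE => n nE; have {}lE : (2 * j)%:R = 2 * j%:R :> F by rewrite natrM.
move: (2 * j)%N lE => l lE.
have p0 : 2 ^+ n.+1 != 0 :> F by rewrite expf_neq0 ?pnatr_eq0.
have r1 : rising 6^-1 j.+1 != 0 :> F by rewrite lt0r_neq0 // rising_gt0 // invr_gt0 ltr0n.
have r2 : rising (5 / 6) l != 0 :> F by rewrite lt0r_neq0 // rising_gt0 // divr_gt0 ?ltr0n.
rewrite !(risingS _ n.+3) !(risingS _ n.+2) !(risingS _ n.+1) (risingS _ j.+1).
rewrite !(risingS _ l.+1) !(risingS _ l) (exprS _ n.+3) (exprS _ n.+2) (exprS _ n.+1).
rewrite -![n.+3%:R]natr1 -![n.+2%:R]natr1 -![n.+1%:R]natr1 -[l.+1%:R]natr1 -[j.+1%:R]natr1.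
rewrite nE lE xE /wz_factor.
move: (rising 2^-1 _) (rising 6^-1 _) (rising (5 / 6) _) (2 ^+ _) r1 r2 p0 => A B C D B0 C0 D0.
by field; rewrite B0 C0 D0 /=; do ?[apply/andP; split];
  first [by apply: lt0r_neq0; lra | by apply: ltr0_neq0; lra].
Qed.

End ClosedForms.

(** * Functions that are quadratic modulo the cube of u *)

Section Quadratic.
Variables (R : comUnitRingType) (u : R).

(** The variable is [u * t] rather than t: when the cube of u is zero, all terms of degree above 2
    vanish, which closes the class under products and inverses. *)
Definition quadratic_in (f : R -> R) :=
  exists a : R * R * R, forall t, f t = a.1.1 + a.1.2 * (u * t) + a.2 * (u * t) ^+ 2.

Lemma quadratic_linear a b : quadratic_in (fun t => a + b * (u * t)).
Proof. by exists (a, b, 0) => t /=; ring. Qed.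

Lemma quadratic_const a : quadratic_in (fun=> a).
Proof. by exists (a, 0, 0) => t /=; ring. Qed.

Lemma eq_quadratic f g : f =1 g -> quadratic_in f -> quadratic_in g.
Proof. by move=> fg [a fa]; exists a => t; rewrite -fg. Qed.

Lemma quadraticD f g : quadratic_in f -> quadratic_in g -> quadratic_in (fun t => f t + g t).
Proof.
case=> [[[a0 a1] a2] fE] [[[b0 b1] b2] gE].
by exists (a0 + b0, a1 + b1, a2 + b2) => t; rewrite fE gE /=; ring.
Qed.

Lemma quadratic_scale c f : quadratic_in f -> quadratic_in (fun t => f (c * t)).
Proof.
case=> [[[a0 a1] a2] fE].
by exists (a0, a1 * c, a2 * c ^+ 2) => t; rewrite fE /=; ring.
Qed.

Hypothesis u3 : u ^+ 3 = 0.

Lemma quadraticM f g : quadratic_in f -> quadratic_in g -> quadratic_in (fun t => f t * g t).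
Proof.
case=> [[[a0 a1] a2] fE] [[[b0 b1] b2] gE].
exists (a0 * b0, a0 * b1 + a1 * b0, a0 * b2 + a1 * b1 + a2 * b0) => t; rewrite fE gE /=.
by ring: u3.
Qed.

Lemma quadraticV f : f 0 \is a GRing.unit -> quadratic_in f -> quadratic_in (fun t => (f
  t)^-1).
Proof.
move=> + [[[a0 a1] a2] fE]; rewrite fE /= !mulr0 expr0n /= mulr0 !addr0 => a0u.
(* The Taylor coefficients of 1 / (a0 + a1 s + a2 s^2) up to degree 2. *)
exists (a0^-1, - a1 * a0^-1 ^+ 2, a1 ^+ 2 * a0^-1 ^+ 3 - a2 * a0^-1 ^+ 2) => t /=.
have := mulrV a0u; move: (a0^-1) => v av.
have e : f t * (v + - a1 * v ^+ 2 * (u * t) + (a1 ^+ 2 * v ^+ 3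
  - a2 * v ^+ 2) * (u * t) ^+ 2) = 1.
  by rewrite fE /=; ring: u3 av.
have fu : f t \is a GRing.unit by apply/unitrPr; eexists; exact: e.
by apply: (mulrI fu); rewrite mulrV.
Qed.

Lemma quadratic_sum n (f : nat -> R -> R) : (forall i, (i < n)%N -> quadratic_in (f i)) ->
  quadratic_in (fun t => \sum_(i < n) f i t).
Proof.
elim: n => [|n IH] h.
  by apply: eq_quadratic (quadratic_const 0) => t; rewrite big_ord0.
apply: eq_quadratic (fun t => _) (quadraticD (IH _) (h n _)) => // [t|i ni].
  by rewrite big_ord_recr.
by apply: h; rewrite ltnW.
Qed.

Lemma quadratic_prod n (f : nat -> R -> R) : (forall i, (i < n)%N -> quadratic_in (f i)) ->
  quadratic_in (fun t => \prod_(i < n) f i t).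
Proof.
elim: n => [|n IH] h.
  by apply: eq_quadratic (quadratic_const 1) => t; rewrite big_ord0.
apply: eq_quadratic (fun t => _) (quadraticM (IH _) (h n _)) => // [t|i ni].
  by rewrite big_ord_recr.
by apply: h; rewrite ltnW.
Qed.

(** Lagrange interpolation at -1/6, -1/2, 1/2, whose weights at 0 are 9/8, -1/4 and 1/8. *)
Lemma quadratic_interpolation f : 2%:R \is a @GRing.unit R -> 3%:R \is a @GRing.unit R ->
  quadratic_in f -> 8 * f 0 = 9 * f (- 6^-1) - 2 * f (- 2^-1) + f (2^-1).
Proof.
move=> h2 h3 [[[a0 a1] a2] fE]; rewrite !fE /=.
have e6 : 6^-1 = 2^-1 * 3^-1 :> R by rewrite -invrM // -natrM.
have e3 : 3 * 3^-1 = 1 :> R by rewrite mulrV.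
rewrite e6; move: (2^-1) (3^-1) e3 => v w e3; apply/esym/eqP; rewrite -subr_eq0.
rewrite (_ : _ - _ = (3 * w - 1) * (a2 * u ^+ 2 * v ^+ 2 * (3 * w + 1) - 3 * a1 * u * v)).
  by rewrite e3 subrr mul0r.
by ring.
Qed.

End Quadratic.

(** * Products over p consecutive integers *)

Section WindowPolynomial.
Variable p : nat.
Hypothesis p_pr : prime p.

Definition window_factor (S : nzRingType) (j : nat) : {poly S} :=
  if (p %| j)%N then 1 else 'X + j%:R%:P.

(** Its value at ps is the product of the integers prime to p among the p integers from n + ps on,
    that is, up to sign, the quotient of two Gamma values at distance p. The ring varies because the
    coefficients are integers that are read both modulo p and modulo p^3. *)
Definition window_poly (S : nzRingType) (n : nat) : {poly S} :=
  \prod_(n <= j < n + p) window_factor S j.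

Lemma map_window_poly (S T : comNzRingType) (f : {rmorphism S -> T}) n :
  map_poly f (window_poly S n) = window_poly T n.
Proof.
rewrite rmorph_prod; apply: eq_bigr => i _; rewrite /window_factor; case: ifP => _.
  by rewrite rmorph1.
by rewrite rmorphD /= map_polyX map_polyC /= rmorph_nat.
Qed.

(** Modulo p the window runs through all nonzero residues wherever it starts. *)
Lemma window_poly_Fp n : window_poly 'F_p n = 'X^(p.-1) - 1.
Proof.
have p_gt0 := prime_gt0 p_pr.
have -> : window_poly 'F_p n = window_poly 'F_p 0.
  elim: n => // n <-; rewrite /window_poly [RHS]big_ltn ?addSn; last by lia.
  rewrite big_nat_recr /=; last by lia.
  rewrite mulrC.
  congr (_ * _); rewrite /window_factor dvdn_addl // natrD.
  by rewrite (pchar_Fp_0 p_pr) addr0.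
(* Multiplying by ['X] restores the factor of the residue 0 and gives X^p - X, the product over the
   whole field. *)
apply: (mulfI (negbT (polyX_eq0 'F_p))); rewrite mulrBr mulr1 -exprS prednK //.
have -> : 'X^p = 'X^#|'F_p| :> {poly 'F_p} by rewrite (card_Fp p_pr).
rewrite finField_genPoly (reindex_inj (@oppr_inj 'F_p)) /=.
transitivity (\prod_(x : 'F_p) ('X + (x : nat)%:R%:P) : {poly 'F_p}); last first.
  by apply: eq_bigr => x _; rewrite rmorphN opprK natr_Zp.
have castE n' : n' = p -> \prod_(i < n') ('X + (i : nat)%:R%:P) =
    \prod_(0 <= i < p) ('X + (i : nat)%:R%:P) :> {poly 'F_p} by move->; rewrite big_mkord.
transitivity (\prod_(0 <= i < p) ('X + (i : nat)%:R%:P) : {poly 'F_p}); last first.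
  exact: esym (castE _ (Fp_cast p_pr)).
rewrite /window_poly add0n [in LHS]big_ltn // [in RHS]big_ltn //.
rewrite {1}/window_factor dvdn0 mul1r addr0; congr (_ * _).
rewrite big_nat_cond [RHS]big_nat_cond; apply: eq_bigr => i.
by rewrite andbT => /andP[i0 ip]; rewrite /window_factor gtnNdvd.
Qed.

Lemma window_poly_coef_dvd n i : (i < p.-1)%N ->
  (p %| ((window_poly int n)`_i + (i == 0%N)%:R))%Z.
Proof.
move=> ip; rewrite (dvdz_pcharf (pchar_Fp p_pr)) rmorphD /= -coef_map.
rewrite map_window_poly window_poly_Fp coefB coefXn coef1 ltn_eqF // sub0r.
by rewrite rmorph_nat addNr.
Qed.

End WindowPolynomial.

(** * Reducing rational numbers into a ring *)

Section Reduction.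
Variable R : comUnitRingType.

(* On the rationals with a denominator that is invertible in R, [reduces_to] is
   the graph of the ring morphism to R; see [reduces_to_ratr]. *)
Definition reduces_to (q : rat) (x : R) : Prop :=
  exists n d : int, [/\ (d%:~R : R) \is a GRing.unit, q * d%:~R = n%:~R & x * d%:~R = n%:~R].

Lemma unit_intr_neq0 (d : int) : (d%:~R : R) \is a GRing.unit -> d%:~R != 0 :> rat.
Proof. by apply: contraL; rewrite intr_eq0 => /eqP ->; rewrite unitr0. Qed.

(** The fraction n / d need not be in lowest terms, but the reduced denominator divides d and is
    therefore a unit as well. *)
Lemma reduces_to_ratr q x : reduces_to q x -> ratr q = x.
Proof.
case=> n [d [du qE xE]].
have e : numq q * d = n * denq q.
  apply: (@intr_inj rat); rewrite !rmorphM /= -qE numqE.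
  exact: mulrAC.
have den_unit : ((denq q)%:~R : R) \is a GRing.unit.
  have /dvdzP[c cE] : (denq q %| d)%Z.
    have : (denq q %| numq q * d)%Z by rewrite e dvdz_mull.
    by rewrite Gauss_dvdzr // coprimez_sym /coprimez -[_ == _]/(coprime _ _) coprime_num_den.
  by move: du; rewrite cE rmorphM /= unitrM => /andP[].
apply: (mulIr den_unit); rewrite /ratr divrK //; apply: (mulIr du).
by rewrite mulrAC xE -!rmorphM /= -e mulrC.
Qed.

Lemma reduces_to_unique q x y : reduces_to q x -> reduces_to q y -> x = y.
Proof. by move=> /reduces_to_ratr <- /reduces_to_ratr. Qed.

Lemma reduces_to_nat n : reduces_to n%:R n%:R.
Proof. by exists n%:Z, 1; rewrite unitr1 !mulr1. Qed.

Lemma reduces_toD q x r y : reduces_to q x -> reduces_to r y -> reduces_to (q + r) (x + y).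
Proof.
move=> [n [d [du qE xE]]] [n' [d' [du' rE yE]]]; exists (n * d' + n' * d), (d * d').
rewrite !rmorphM !rmorphD /= unitrM du du' !rmorphM /= -qE -rE -xE -yE.
by split=> //; ring.
Qed.

Lemma reduces_toM q x r y : reduces_to q x -> reduces_to r y -> reduces_to (q * r) (x * y).
Proof.
move=> [n [d [du qE xE]]] [n' [d' [du' rE yE]]]; exists (n * n'), (d * d').
rewrite !rmorphM /= unitrM du du' -qE -rE -xE -yE.
by split=> //; ring.
Qed.

Lemma reduces_toN q x : reduces_to q x -> reduces_to (- q) (- x).
Proof.
by move=> [n [d [du qE xE]]]; exists (- n), d; rewrite !rmorphN /= !mulNr qE xE.
Qed.

Lemma reduces_toV q x : x \is a GRing.unit -> reduces_to q x -> reduces_to q^-1 x^-1.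
Proof.
move=> xu [n [d [du qE xE]]]; exists d, n.
have nu : (n%:~R : R) \is a GRing.unit by rewrite -xE unitrM xu.
have q0 : q != 0.
  by apply: contraNneq (unit_intr_neq0 nu) => q0; rewrite -qE q0 mul0r.
by split; rewrite // -?qE -?xE ?mulKf ?mulKr.
Qed.

Lemma reduces_toX q x k : reduces_to q x -> reduces_to (q ^+ k) (x ^+ k).
Proof.
move=> qx; elim: k => [|k IH]; first exact: (reduces_to_nat 1).
by rewrite !exprS; apply: reduces_toM.
Qed.

Lemma reduces_to_prod (f : nat -> rat) (g : nat -> R) k :
  (forall i, (i < k)%N -> reduces_to (f i) (g i)) ->
  reduces_to (\prod_(i < k) f i) (\prod_(i < k) g i).
Proof.
elim: k => [|k IH] h; first by rewrite !big_ord0; apply: (reduces_to_nat 1).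
by rewrite !big_ord_recr; apply: reduces_toM; [apply: IH => i ik; apply: h;
  apply: ltnW|apply: h].
Qed.

Lemma reduces_to_sum (f : nat -> rat) (g : nat -> R) k :
  (forall i, (i < k)%N -> reduces_to (f i) (g i)) ->
  reduces_to (\sum_(i < k) f i) (\sum_(i < k) g i).
Proof.
elim: k => [|k IH] h; first by rewrite !big_ord0; apply: (reduces_to_nat 0).
by rewrite !big_ord_recr; apply: reduces_toD; [apply: IH => i ik; apply: h;
  apply: ltnW|apply: h].
Qed.

Lemma reduces_to_rising q x k : reduces_to q x -> reduces_to (rising q k) (rising x k).
Proof.
move=> qx; apply: (reduces_to_prod (f := fun i => q + i%:R) (g := fun i => x + i%:R)) => i _.
by apply: reduces_toD (reduces_to_nat i).
Qed.

Lemma reduces_to_sum_term q x k : 2%:R \is a @GRing.unit R ->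
    (forall i, (i < k)%N -> 1 + i%:R \is a @GRing.unit R) ->
    (forall i, (i < k)%N -> 1 + 2 * x + i%:R \is a GRing.unit) ->
    (forall i, (i < k)%N -> 1 + x + i%:R \is a GRing.unit) ->
  reduces_to q x -> reduces_to (\sum_(i < k.+1) term q i) (\sum_(i < k.+1) term x i).
Proof.
move=> u2 u0 ud ue qx; apply: (reduces_to_sum (f := term q) (g := term x)) => i;
  rewrite ltnS => ik.
apply: (reduces_to_prod (f := fun i => term_ratio q i%:R)
  (g := fun i => term_ratio x i%:R)) => j ji.
have jk : (j < k)%N by apply: leq_trans ik.
have u8 : 8%:R \is a @GRing.unit R by rewrite (natrX _ 2 3) unitrX.
have nat n : reduces_to n%:R n%:R := reduces_to_nat n.
have N := reduces_toN; have D := reduces_toD; have M := reduces_toM.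
have c2 := reduces_toV u2 (nat 2%N); have c8 := reduces_toV u8 (nat 8%N).
have one := nat 1%N.
apply: (M); last apply: reduces_toV.
- by do !apply: (M); try exact: (N); do !apply: (D) => //; do ?apply: (M) => //; apply: (N).
- by rewrite !unitrM u0 // ud // ue.
- by do !apply: (M); do !apply: (D) => //; apply: (M).
Qed.

End Reduction.

(* Gauss' lemma for the residue 2: the even numbers above p/2 are the negatives
   of the odd numbers below p/2. *)
Lemma two_expn_Fp p m : prime p -> p = (4 * m + 1)%N -> 2 ^+ (2 * m) = (-1) ^+ m :> 'F_p.
Proof.
move=> p_pr pE.
have p0 : (4 * m + 1)%:R = 0 :> 'F_p by rewrite -pE (pchar_Fp_0 p_pr).
rewrite natrD natrM in p0.
have fact_unit k : (k < p)%N -> k`!%:R != 0 :> 'F_p.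
  elim: k => [|k IH] kp; first by rewrite oner_neq0.
  rewrite factS natrM mulf_neq0 ?IH ?(ltnW kp) //.
  by rewrite -unitfE (unitFpE p_pr) prime_coprime // gtnNdvd.
apply: (mulfI (fact_unit (2 * m)%N _)); first by lia.
have factE n : (n`!%:R = \prod_(i < n) (i%:R + 1) :> 'F_p).
  elim: n => [|n IH]; first by rewrite big_ord0.
  by rewrite factS big_ord_recr /= natrM IH natr1 mulrC.
have evens : (2 * m)`!%:R * 2 ^+ (2 * m) = \prod_(i < 2 * m) (2 * (i%:R + 1)) :> 'F_p.
  by rewrite factE big_split /= prodr_const card_ord mulrC.
have odds n : (2 * n)`!%:R = \prod_(i < n) ((2 * i%:R + 1) * (2 * (i%:R + 1))) :> 'F_p.
  elim: n => [|n IH]; first by rewrite big_ord0.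
  rewrite mulnS factS factS big_ord_recr /= !natrM -IH -[_.+2%:R]natr1 -[_.+1%:R]natr1 natrM.
  by ring.
rewrite evens odds mul2n -addnn big_split_ord /= [in RHS]big_split /= [LHS]mulrC [RHS]mulrAC.
congr (_ * _); rewrite (reindex_inj rev_ord_inj) /= -[X in _ ^+ X]card_ord -prodr_const
  -[RHS]big_split.
apply: eq_bigr => i _ /=; apply/eqP; rewrite -subr_eq0 -p0; apply/eqP.
have := ltn_ord i; move: (nat_of_ord i) => k km.
have -> : (m + (m - k.+1))%:R = 2 * m%:R - k%:R - 1 :> 'F_p.
  by rewrite natrD natrB // -natr1; ring.
by ring.
Qed.

Lemma two_expn_mod p m : prime p -> p = (4 * m + 1)%N ->
  exists d : int, 2 ^+ (2 * m) = (-1) ^+ m * (1 + p%:Z * d).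
Proof.
move=> p_pr pE.
have /dvdzP[z zE] : (p %| (2 ^+ (2 * m) - (-1) ^+ m : int))%Z.
  rewrite (dvdz_pcharf (pchar_Fp p_pr)) rmorphB /= !rmorphXn /= rmorphN1.
  by rewrite -[2%:~R]/(2%:R) two_expn_Fp // subrr.
have s : (-1) ^+ m * (-1) ^+ m = 1 :> int by rewrite -exprMn mulrNN mulr1 expr1n.
exists ((-1) ^+ m * z); rewrite -[LHS](subrK ((-1) ^+ m)) zE.
move: ((-1) ^+ m) s => e s; rewrite mulrDr mulr1 mulrCA [e * (e * z)]mulrA s.
by ring.
Qed.

Lemma horner_cube_zero (R : comNzRingType) (q : {poly R}) (y : R) :
  y ^+ 3 = 0 -> q.[y] = q`_0 + q`_1 * y + q`_2 * y ^+ 2.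
Proof.
move=> y3; rewrite (@horner_coef_wide _ (3 + size q)) ?leq_addl //.
rewrite big_split_ord /= [X in _ + X]big1 ?addr0 => [|i _].
  by rewrite !big_ord_recr big_ord0 /= expr0 expr1 mulr1 add0r.
by rewrite exprD y3 mul0r mulr0.
Qed.

(** * The Gamma function modulo p^3, from its functional equation alone *)

Section ModCubeGamma.
Variables (R : comUnitRingType) (p : nat) (gam : R -> R).
Hypotheses (p_pr : prime p) (p_gt3 : (3 < p)%N).
Hypothesis natR : forall x : R, exists n, x = n%:R.
Hypothesis unitR : forall n, ((n%:R : R) \is a GRing.unit) = ~~ (p %| n)%N.
Hypothesis p3 : (p%:R : R) ^+ 3 = 0.
Hypothesis gam0 : gam 0 = 1.
Hypothesis gamS : forall x, gam (x + 1) = (if x \is a GRing.unit then - x else -1) * gam x.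

Lemma sqr_gam_rising x k : (forall i, (i < k)%N -> x + i%:R \is a GRing.unit) ->
  gam (x + k%:R) ^+ 2 = rising x k ^+ 2 * gam x ^+ 2.
Proof.
elim: k => [|k IH] h; first by rewrite addr0 rising0 expr1n mul1r.
rewrite -natr1 addrA gamS h // risingS exprMn IH; first by ring.
by move=> i ik; apply: h; rewrite ltnW.
Qed.

Lemma gam1 : gam 1 = -1.
Proof. by have := gamS 0; rewrite add0r unitr0 gam0 mulr1. Qed.

(** From x to x + 1 the two Gamma values change by factors that cancel up to sign. *)
Lemma sqr_gam_reflection x : gam x ^+ 2 * gam (1 - x) ^+ 2 = 1.
Proof.
rewrite -exprMn; have [n ->] := natR x; elim: n => [|n IH].
  by rewrite subr0 gam0 gam1; ring.
have e : 1 - n%:R = - n%:R + 1 :> R by rewrite addrC.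
rewrite -[RHS]IH e.
have -> : 1 - n.+1%:R = - n%:R :> R by rewrite -natr1; ring.
by rewrite -natr1 !gamS unitrN; case: ifP => _; ring.
Qed.

(** The exponent counts the integers from 1 to n that are prime to p; only these flip the sign. *)
Lemma gam_reflection n : gam n.+1%:R * gam (- n%:R) = - (-1) ^+ (n - n %/ p).
Proof.
elim: n => [|n IH]; first by rewrite oppr0 gam0 gam1 mulr1 div0n subn0.
have e : - n%:R = - n.+1%:R + 1 :> R by rewrite -natr1; ring.
move: IH; rewrite e gamS unitrN unitR -[n.+2%:R]natr1 gamS unitR opprK.
rewrite divnS ?prime_gt0 //; case: (p %| n.+1)%N => /=.
  by rewrite add1n subSS => <-; ring.
by rewrite add0n subSn ?leq_div // exprS => IH; rewrite -[RHS]mulrN -IH; ring.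
Qed.

Lemma sqr_gam_half m : p = (4 * m + 1)%N -> gam 2^-1 ^+ 2 = -1.
Proof.
(* Here n = (p^3 - 1) / 2, so [n.+1] and [- n] both represent 1/2 modulo p^3; moreover n - n/p is
   even because p = 1 mod 4. *)
move=> pE; pose n := (p * (8 * m ^ 2 + 4 * m) + 2 * m)%N.
have nE : (2 * n + 1 = p ^ 3)%N by rewrite /n pE; ring.
have n_div : (n %/ p = 8 * m ^ 2 + 4 * m)%N.
  by rewrite /n mulnC divnMDl ?prime_gt0 // divn_small ?addn0 // pE; lia.
have n0 : 2 * n%:R + 1 = 0 :> R by rewrite -natrM natr1 -addn1 nE natrX p3.
have two : 2%:R \is a @GRing.unit R by rewrite unitR gtnNdvd // ltnW.
have h1 : n.+1%:R = 2^-1 :> R.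
  by apply: (mulrI two); rewrite mulrV // -[n.+1%:R]natr1 -[RHS]add0r -n0; ring.
have h2 : - n%:R = 2^-1 :> R.
  by apply: (mulrI two); rewrite mulrV // -[RHS]subr0 -n0; ring.
have := gam_reflection n; rewrite h1 h2 n_div -expr2 => ->; congr (- _).
have -> : (n - (8 * m ^ 2 + 4 * m) = 2 * (4 * m * (8 * m ^ 2 + 4 * m) %/ 2 + m))%N.
  have -> : (4 * m * (8 * m ^ 2 + 4 * m) = 2 * m * (8 * m ^ 2 + 4 * m) * 2)%N by ring.
  by rewrite mulnK // /n pE; lia.
by rewrite exprM sqrrN expr1n expr1n.
Qed.

Lemma gam_add_window n s :
  gam (n%:R + p%:R * s%:R + p%:R) =
  (-1) ^+ p * (window_poly p R n).[p%:R * s%:R] * gam (n%:R + p%:R * s%:R).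
Proof.
suff h k : gam (n%:R + p%:R * s%:R + k%:R) = (-1) ^+ k *
    (\prod_(n <= j < n + k) window_factor p R j).[p%:R * s%:R] * gam (n%:R + p%:R * s%:R).
  exact: h.
elim: k => [|k IH].
  by rewrite addr0 addn0 big_geq // !hornerE.
rewrite -natr1 addrA gamS IH addnS big_nat_recr ?leq_addr //= hornerM.
have -> : n%:R + p%:R * s%:R + k%:R = (n + k + p * s)%:R :> R by rewrite !natrD natrM; ring.
rewrite unitR dvdn_addl ?dvdn_mulr // exprS; move: (\prod_(n <= i < n + k) _).[_] => W.
rewrite /window_factor; case: (p %| n + k)%N => /=; first by rewrite -polyC1 hornerC; ring.
by rewrite hornerD hornerX hornerC !natrD natrM; ring.
Qed.

(** The window polynomial is -1 modulo p up to degree 2, so a step from s to s + 1 multiplies gam(n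
    + ps) by 1 + pa + p^2 bs modulo p^3, with a and b independent of s. Since every t is the image
    of some s, induction on s suffices. *)
Lemma quadratic_gam c k : 2%:R \is a @GRing.unit R ->
  quadratic_in (p%:R : R) (fun t => gam (c + k * (p%:R * t))).
Proof.
move=> h2.
suff h : quadratic_in (p%:R : R) (fun t => gam (c + p%:R * t)).
  by apply: eq_quadratic (quadratic_scale k h) => t; congr (gam (_ + _)); ring.
have [n ->] := natR c.
have dvd i : (i < 3)%N -> exists z : int, (window_poly p R n)`_i = - (i == 0%N)%:R
  + p%:R * z%:~R.
  move=> i3; have /dvdzP[z zE] : (p %| ((window_poly p int n)`_i + (i == 0%N)%:R))%Z.
    by apply: window_poly_coef_dvd => //; lia.
  exists z; have := congr1 (fun x : int => x%:~R : R) zE; rewrite !rmorphM rmorphD /=.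
  have -> : (window_poly p R n)`_i = ((window_poly p int n)`_i)%:~R.
    by rewrite -(@map_window_poly p int R (intmul 1)) coef_map.
  rewrite rmorph_nat => e; rewrite -[LHS](addrK (i == 0%N)%:R) e.
  by rewrite addrC mulrC.
have [z0 w0] := dvd 0%N isT; have [z1 w1] := dvd 1%N isT; have [z2 w2] := dvd 2%N isT.
have p_odd : odd p by have [p2|] := even_prime p_pr; first by move: p_gt3; rewrite p2.
set a : R := - z0%:~R; set b : R := - z1%:~R.
have step s : gam (n%:R + p%:R * s.+1%:R) =
    (1 + p%:R * a + p%:R ^+ 2 * b * s%:R) * gam (n%:R + p%:R * s%:R).
  rewrite -[s.+1%:R]natr1 mulrDr mulr1 addrA gam_add_window -signr_odd p_odd expr1.
  rewrite horner_cube_zero; last by rewrite exprMn p3 mul0r.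
  rewrite w0 w1 w2 /= /a /b; congr (_ * _).
  by ring: p3.
(* The product of 1 + pa + p^2 bi over i < s is 1 + pas + p^2 (a^2 + b) s(s-1)/2 modulo p^3; its
   coefficients are expressed through [e]. *)
pose e := (a ^+ 2 + b) / 2%:R.
have bE : b = 2 * e - a ^+ 2 by rewrite /e [2 * _]mulrC divrK // addrC addKr.
exists (gam n%:R, gam n%:R * (a - p%:R * e), gam n%:R * e) => t /=.
have [s ->] := natR t; elim: s => [|s IH];
  first by rewrite !mulr0 addr0 expr0n /= !mulr0 !addr0.
rewrite step IH -natr1 bE; move: (s%:R) (gam n%:R) => x g.
by ring: p3.
Qed.

(* [ring] does not reduce modulo an equation [6 * h = 1]; the cofactor c is given explicitly. *)
Lemma eq_sub_mul (l r x y c : R) : l = r -> x - y = (l - r) * c -> x = y.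
Proof. by move=> -> /eqP; rewrite subrr mul0r subr_eq0 => /eqP. Qed.

Lemma natr_unit k : (0 < k < p)%N -> (k%:R : R) \is a GRing.unit.
Proof. by case/andP=> k0 kp; rewrite unitR gtnNdvd. Qed.

Lemma unit_multiple c k (x : R) : c * x = k%:R -> ~~ (p %| k)%N -> x \is a GRing.unit.
Proof. by move=> e; rewrite -unitR -e unitrM => /andP[]. Qed.

Lemma rising_unit (x : R) k : (forall i, (i < k)%N -> x + i%:R \is a GRing.unit) ->
  rising x k \is a GRing.unit.
Proof.
elim: k => [|k IH] h; first by rewrite rising0 unitr1.
by rewrite risingS unitrM IH ?h // => i ik; apply: h; rewrite ltnW.
Qed.

Let u : R := p%:R.

Lemma quadratic_sum_term k : (k <= p)%N ->
  quadratic_in u (fun t => \sum_(i < k) term (u * t) i).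
Proof.
move=> kp; apply: (@quadratic_sum _ _ k (fun i t => term (u * t) i)) => i ik.
apply: (@quadratic_prod _ _ p3 i (fun i t => term_ratio (u * t) i%:R)) => j ji.
have lin a b c : quadratic_in u (fun t => a + b * (u * t) + c).
  by apply: eq_quadratic (quadratic_linear u (a + c) b) => t; ring.
have lin1 a c : quadratic_in u (fun t => a + u * t + c).
  by apply: eq_quadratic (lin a 1 c) => t; rewrite mul1r.
have lin2 a c : quadratic_in u (fun t => a - u * t + c).
  by apply: eq_quadratic (lin a (-1) c) => t; rewrite mulN1r.
have qM := quadraticM p3; have cst := quadratic_const u.
apply: (qM _ _ (qM _ _ (qM _ _ (qM _ _ _ _) _) _)); rewrite //.
apply: (quadraticV p3); last exact: (qM _ _ (qM _ _ _ _) _).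
have j1 : 1 + j%:R \is a @GRing.unit R by rewrite addrC natr1 natr_unit //; lia.
by rewrite !mulr0 !addr0 !unitrM j1.
Qed.

(** * Both sides at the three points *)

Section Points.
Variables (m : nat) (eps d : R).
Hypothesis pE : p = (4 * m + 1)%N.
Hypothesis eps2 : eps ^+ 2 = 1.
Hypothesis two_pow : 2 ^+ (2 * m) = eps * (1 + u * d).

(* [V t] is (1 + u d)^(6t) modulo u^3. *)
Let V (t : R) := 1 + (6 * d - 3 * u * d ^+ 2) * (u * t) + 18 * d ^+ 2 * (u * t) ^+ 2.

(** Since p = 4m + 1, at each point the arguments become, up to the reflection of some of them, the
    ends of the rising factorials in the closed form. The factor [1 *] gives the shape of
    [quadratic_gam]. *)
Let G (t : R) := - (eps * V t * (gam (1 + 1 * (u * t)) ^+ 2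
  * gam (4^-1 + 2^-1 * (u * t)) ^+ 2 * gam (4^-1 + (- (3 / 2)) * (u * t)) ^+ 2)).

(** All constants are expressed through h, as in 1/2 = 3h and 1/4 = 9h^2, so that [6 * h = 1] is the
    only relation to supply to [ring]. *)
Let h : R := 6^-1.

Let h6 : 6 * h = 1.
Proof. by rewrite mulrV // (natrM _ 2 3) unitrM !natr_unit // pE; lia. Qed.

Let two_unit : 2%:R \is a @GRing.unit R.
Proof. by rewrite natr_unit // pE; lia. Qed.

Let eight_unit : 8%:R \is a @GRing.unit R.
Proof. by rewrite (natrX _ 2 3) unitrX. Qed.

Let half : 2^-1 = 3 * h :> R.
Proof. by apply: (mulrI two_unit); rewrite mulrV // mulrA -natrM h6. Qed.

Let quarter : 4^-1 = 9 * h ^+ 2 :> R.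
Proof.
have four_unit : 4%:R \is a @GRing.unit R by rewrite natr_unit // pE; lia.
apply: (mulrI four_unit); rewrite mulrV //.
by transitivity ((6 * h) ^+ 2); [rewrite h6 expr1n | ring].
Qed.

Let uE : u = 4 * m%:R + 1.
Proof. by rewrite /u {1}pE natrD natrM. Qed.

Lemma quadratic_gamma_side : quadratic_in u G.
Proof.
have sq f : quadratic_in u f -> quadratic_in u (fun t => f t ^+ 2).
  by move=> qf; apply: (quadraticM p3).
have c := quadratic_const u.
apply: (eq_quadratic (f := fun t => - eps * V t * (gam (1 + 1 * (u * t)) ^+ 2
  * gam (4^-1 + 2^-1 * (u * t)) ^+ 2 * gam (4^-1 + (- (3 / 2)) * (u * t)) ^+ 2))).
  by move=> t; rewrite /G !mulNr.
have qM := quadraticM p3.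
apply: (qM _ _ (qM _ _ (c _) _) (qM _ _ (qM _ _ _ _) _)).
- by eexists (1, _, _) => t.
- exact/sq/quadratic_gam.
- exact/sq/quadratic_gam.
- exact/sq/quadratic_gam.
Qed.

Let u3 : u ^+ 3 = 0 := p3.

Let pow8 : (8 ^+ m) ^+ 2 = eps * (1 + u * d) ^+ 3.
Proof.
have -> : 8 = 2 ^+ 3 :> R by rewrite -natrX.
rewrite -!exprM (_ : 3 * (m * 2) = 2 * m * 3)%N; last by lia.
by rewrite exprM two_pow exprMn exprS eps2 mulr1.
Qed.

Let half_rising_unit i : (i < 2 * m)%N -> 2^-1 + i%:R \is a @GRing.unit R.
Proof.
move=> im; apply: (@unit_multiple 2 (1 + 2 * i)); last by rewrite gtnNdvd //; lia.
by apply: (eq_sub_mul (c := 1) h6); rewrite half (natrD _ 1) (natrM _ 2); ring.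
Qed.

Let sqr_gam_half_add k : (k <= 2 * m)%N ->
  gam (2^-1 + k%:R) ^+ 2 = - rising 2^-1 k ^+ 2.
Proof.
move=> km; rewrite sqr_gam_rising ?(sqr_gam_half pE) ?mulrN1 // => i ik.
by apply: half_rising_unit; lia.
Qed.

(** The arguments are 1 + p/2, 1/2 + m and 1 - (1 + p/2 + m). Reflecting the third leaves the rising
    factorial between the other end and 1 + p/2, and V(1/2) is the power of 1 + ud contained in
    8^(2m). *)
Lemma gamma_side_half :
  G 2^-1 = (8 ^+ m * rising 2^-1 m / rising (3 / 2 + (2 * m)%:R) m) ^+ 2.
Proof.
have u2 i : (i < m)%N -> 1 + 3 * h * u + i%:R \is a @GRing.unit R.
  move=> im; apply: (@unit_multiple 2 (2 + 2 * i + p)).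
    by apply: (eq_sub_mul (c := u) h6);
      rewrite (natrD _ (2 + 2 * i)) (natrD _ 2) (natrM _ 2) /u; ring.
  by rewrite -[X in (_ %| _ + X)%N]mul1n dvdn_addl ?dvdn_mull // gtnNdvd //; lia.
have a1 : 1 + 1 * (u * 2^-1) = 1 + 3 * h * u by rewrite half; ring.
have a2 : 4^-1 + 2^-1 * (u * 2^-1) = 2^-1 + m%:R.
  by apply: (eq_sub_mul (c := 3 * h + m%:R * (6 * h + 1)) h6); rewrite quarter half uE; ring.
have a3 : 4^-1 + - (3 / 2) * (u * 2^-1) = 1 - (1 + 3 * h * u + m%:R).
  apply: (eq_sub_mul (c := - (3 * h + m%:R * (18 * h + 1))) h6).
  by rewrite quarter half uE; ring.
have -> : 3 / 2 + (2 * m)%:R = 1 + 3 * h * u.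
  by apply: (eq_sub_mul (c := 1 - 2 * m%:R) h6); rewrite half uE natrM; ring.
have V1 : V 2^-1 = (1 + u * d) ^+ 3.
  apply: (eq_sub_mul (c := 3 * u * d + u ^+ 2 * d ^+ 2 * (27 * h + 3)) h6).
  by rewrite /V half; ring: u3.
have := sqr_gam_reflection (1 + 3 * h * u + m%:R).
rewrite /G a1 a2 a3 V1 sqr_gam_half_add; last by lia.
rewrite (sqr_gam_rising u2); have := rising_unit u2.
move: (rising (1 + _) m) (rising 2^-1 m) (gam _ ^+ 2) (gam _ ^+ 2) => q r A C qu e.
have q2 : q ^+ 2 \is a GRing.unit by rewrite unitrX.
apply: (mulrI q2); rewrite exprMn exprVn [RHS]mulrC divrK // exprMn pow8.
by ring: e.
Qed.

Lemma gamma_side_neg_half :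
  G (- 2^-1) = (rising m.+1%:R (2 * m) / (8 ^+ m * rising 2^-1 (2 * m))) ^+ 2.
Proof.
have a1 : 1 + 1 * (u * - 2^-1) = 1 - (2^-1 + (2 * m)%:R).
  by apply: (eq_sub_mul (c := - (2 * m%:R)) h6); rewrite half uE natrM; ring.
have a2 : 4^-1 + 2^-1 * (u * - 2^-1) = 1 - m.+1%:R.
  apply: (eq_sub_mul (c := - ((6 * h + 1) * m%:R)) h6).
  by rewrite quarter half uE -natr1; ring.
have a3 : 4^-1 + - (3 / 2) * (u * - 2^-1) = m.+1%:R + (2 * m)%:R.
  apply: (eq_sub_mul (c := (6 * h + 1) * (1 + 3 * m%:R)) h6).
  by rewrite quarter half uE -natr1 natrM; ring.
have V1 : V (- 2^-1) * (1 + u * d) ^+ 3 = 1.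
  apply: (eq_sub_mul (c := - (3 * u * d) + u ^+ 2 * d ^+ 2 * (27 * h - 3)) h6).
  by rewrite /V half; ring: u3.
have u1 i : (i < 2 * m)%N -> m.+1%:R + i%:R \is a @GRing.unit R.
  by move=> im; rewrite -natrD natr_unit //; lia.
have := sqr_gam_reflection (2^-1 + (2 * m)%:R); have := sqr_gam_reflection m.+1%:R.
rewrite /G a1 a2 a3 sqr_gam_half_add // (sqr_gam_rising u1).
have := rising_unit half_rising_unit.
move: (rising 2^-1 _) (rising m.+1%:R _) (gam (1 - (_ + _)) ^+ 2) (gam (1 - _) ^+ 2).
move: (gam m.+1%:R ^+ 2) (V _) V1 => g v V1 r q A B ru e1 e2.
have w : (8 ^+ m * r) ^+ 2 \is a GRing.unit.
  by rewrite unitrX // unitrM ru andbT unitrX // eight_unit.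
move DE: (8 ^+ m * r) w => D w.
apply: (mulrI w); rewrite exprMn exprVn [RHS]mulrC divrK // -DE exprMn pow8.
transitivity (eps ^+ 2 * (v * (1 + u * d) ^+ 3) * (- r ^+ 2 * A) * (g * B) * q ^+ 2);
  first by ring.
by rewrite eps2 V1 e1 e2; ring.
Qed.

(** [Z] stands for the product of two rising factorials whose form depends on p modulo 3. The Gamma
    arguments in its square are p/6 and 3/4 + p/12. *)
Lemma gamma_side_neg_sixth Z :
    Z ^+ 2 = gam (u * h) ^+ 2 * gam (1 - 9 * h ^+ 2 + 3 * h ^+ 2 * u) ^+ 2 ->
  G (- 6^-1) = (rising 2^-1 m / (2 ^+ m * Z)) ^+ 2.
Proof.
move=> ZE; rewrite -/h.
have a1 : 1 + 1 * (u * - h) = 1 - u * h by ring.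
have a2 : 4^-1 + 2^-1 * (u * - h) = 1 - (1 - 9 * h ^+ 2 + 3 * h ^+ 2 * u).
  by rewrite quarter half; ring.
have a3 : 4^-1 + - (3 / 2) * (u * - h) = 2^-1 + m%:R.
  by apply: (eq_sub_mul (c := 3 * h + m%:R * (6 * h + 1)) h6); rewrite quarter half uE; ring.
have V1 : V (- h) * (1 + u * d) = 1.
  apply: (eq_sub_mul (c := - (u * d) + 3 * h * u ^+ 2 * d ^+ 2) h6).
  by rewrite /V; ring: u3.
have := sqr_gam_reflection (u * h).
have := sqr_gam_reflection (1 - 9 * h ^+ 2 + 3 * h ^+ 2 * u).
rewrite /G a1 a2 a3 sqr_gam_half_add; last by lia.
have p2 : (2 ^+ m) ^+ 2 = eps * (1 + u * d) by rewrite -exprM mulnC.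
move: ZE (gam (1 - u * h) ^+ 2) (gam (1 - (_ + _)) ^+ 2) (rising 2^-1 m).
move: (gam (u * h) ^+ 2) (gam (_ + _) ^+ 2) (V _) V1 => g g' v V1 ZE A B r e1 e2.
have Zu : Z \is a GRing.unit.
  by rewrite -(@unitrX_pos _ _ 2) // ZE; apply/unitrPr; exists (A * B); ring: e1 e2.
have w : (2 ^+ m * Z) ^+ 2 \is a GRing.unit.
  by rewrite unitrX // unitrM Zu andbT unitrX.
move DE: (2 ^+ m * Z) w => D w.
apply: (mulrI w); rewrite exprMn exprVn [RHS]mulrC divrK // -DE exprMn p2 ZE.
transitivity (eps ^+ 2 * (v * (1 + u * d)) * (g * A) * (g' * B) * r ^+ 2); first by ring.
by rewrite eps2 V1 e1 e2; ring.
Qed.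

Lemma sum_term_zero Z :
    \sum_(i < (2 * m).+1) term (u * 2^-1) i =
      (8 ^+ m * rising 2^-1 m / rising (3 / 2 + (2 * m)%:R) m) ^+ 2 ->
    \sum_(i < (2 * m).+1) term (- (u * 2^-1)) i =
      (rising m.+1%:R (2 * m) / (8 ^+ m * rising 2^-1 (2 * m))) ^+ 2 ->
    \sum_(i < (2 * m).+1) term (- (u * 6^-1)) i = (rising 2^-1 m / (2 ^+ m * Z)) ^+ 2 ->
    Z ^+ 2 = gam (u * h) ^+ 2 * gam (1 - 9 * h ^+ 2 + 3 * h ^+ 2 * u) ^+ 2 ->
  \sum_(i < (2 * m).+1) term (0 : R) i = - (eps * gam 4^-1 ^+ 4).
Proof.
move=> hB hA hC /gamma_side_neg_sixth hZ.
have three : 3%:R \is a @GRing.unit R by rewrite natr_unit //; lia.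
have q := @quadratic_sum_term (2 * m).+1 _.
have := quadratic_interpolation two_unit three (q ltac:(lia)).
rewrite mulr0 !mulrN hA hB hC -gamma_side_half -gamma_side_neg_half -hZ.
rewrite -(quadratic_interpolation two_unit three quadratic_gamma_side) => /(mulrI eight_unit)
  ->.
by rewrite /G /V !mulr0 !addr0 expr0n /= mulr0 !addr0 gam1; ring.
Qed.

Let five_sixth : 5 / 6 = 1 - h.
Proof. by apply: (eq_sub_mul (c := 1) h6); rewrite -/h; ring. Qed.

Let sixth_unit k r i : 6 * r = k%:R :> R -> (0 < k + 6 * i < p)%N ->
  r + i%:R \is a @GRing.unit R.
Proof.
move=> rE /andP[k0 kp]; apply: (@unit_multiple 6 (k + 6 * i)); last by rewrite gtnNdvd.
by rewrite mulrDr rE (natrD _ k) (natrM _ 6).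
Qed.

(** For p = 12j + 1 the two arguments are 1/6 + 2j and 5/6 + j, and reflection at 1/6 removes the
    remaining Gamma values. For p = 12j + 5 they are 5/6 + 2j and 1/6 + (j + 1). *)
Lemma sqr_rising_sixth_1 j : m = (3 * j)%N ->
  (rising h (2 * j) * rising (5 / 6) j) ^+ 2 =
  gam (u * h) ^+ 2 * gam (1 - 9 * h ^+ 2 + 3 * h ^+ 2 * u) ^+ 2.
Proof.
move=> mE.
have a1 : u * h = h + (2 * j)%:R.
  by apply: (eq_sub_mul (c := 2 * j%:R) h6); rewrite uE mE !natrM; ring.
have a2 : 1 - 9 * h ^+ 2 + 3 * h ^+ 2 * u = 1 - h + j%:R.
  apply: (eq_sub_mul (c := j%:R * (6 * h + 1) - h) h6).
  by rewrite uE mE natrM; ring.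
rewrite a1 a2 five_sixth !sqr_gam_rising.
- by have := sqr_gam_reflection h; move: (gam h) (gam _) => A B e; ring: e.
- move=> i ij; apply: (@sixth_unit 5); last by rewrite pE mE; lia.
  by rewrite mulrBr h6; ring.
- by move=> i ij; apply: (@sixth_unit 1); rewrite ?h6 // pE mE; lia.
Qed.

Lemma sqr_rising_sixth_5 j : m = (3 * j + 1)%N ->
  (rising (5 / 6) (2 * j) * rising h (j + 1)) ^+ 2 =
  gam (u * h) ^+ 2 * gam (1 - 9 * h ^+ 2 + 3 * h ^+ 2 * u) ^+ 2.
Proof.
move=> mE.
have a1 : u * h = 1 - h + (2 * j)%:R.
  by apply: (eq_sub_mul (c := 1 + 2 * j%:R) h6); rewrite uE mE (natrD _ (3 * j)) !natrM; ring.
have a2 : 1 - 9 * h ^+ 2 + 3 * h ^+ 2 * u = h + (j + 1)%:R.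
  apply: (eq_sub_mul (c := h + j%:R * (6 * h + 1)) h6).
  by rewrite uE mE (natrD _ (3 * j)) (natrD _ j) natrM; ring.
rewrite a1 a2 five_sixth !sqr_gam_rising.
- by have := sqr_gam_reflection h; move: (gam h) (gam _) => A B e; ring: e.
- by move=> i ij; apply: (@sixth_unit 1); rewrite ?h6 // pE mE; lia.
- move=> i ij; apply: (@sixth_unit 5); last by rewrite pE mE; lia.
  by rewrite mulrBr h6; ring.
Qed.

Let unit_add_nilpotent a b : a \is a GRing.unit -> a + u * b \is a GRing.unit.
Proof.
move=> au; have e : (a + u * b) * (a ^+ 2 - a * (u * b) + (u * b) ^+ 2) = a ^+ 3 by ring: u3.
by have := unitrX 3 au; rewrite -e unitrM => /andP[].
Qed.

(** A multiple of the nilpotent u changes the denominators of the terms from the units 1 + i only by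
    nilpotents. *)
Let reduces_to_sum_term_nilpotent (q : rat) x c : x = u * c -> reduces_to q x ->
  reduces_to (\sum_(i < (2 * m).+1) term q i) (\sum_(i < (2 * m).+1) term x i).
Proof.
move=> xE; have u1 i : (i < 2 * m)%N -> 1 + i%:R \is a @GRing.unit R.
  by move=> im; rewrite addrC natr1 natr_unit //; lia.
apply: reduces_to_sum_term => // i im.
  rewrite (_ : _ + i%:R = 1 + i%:R + u * (2 * c)); last by rewrite xE; ring.
  exact: unit_add_nilpotent (u1 _ _).
rewrite (_ : _ + i%:R = 1 + i%:R + u * c); last by rewrite xE; ring.
exact: unit_add_nilpotent (u1 _ _).
Qed.

Let six_unit : 6%:R \is a @GRing.unit R.
Proof. by rewrite (natrM _ 2 3) unitrM !natr_unit // pE; lia. Qed.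

Let rat_half : reduces_to 2^-1 (2^-1 : R).
Proof. exact: reduces_toV (reduces_to_nat _ 2). Qed.

Let rat_sixth : reduces_to 6^-1 h.
Proof. exact: reduces_toV (reduces_to_nat _ 6). Qed.

Let rat_five_sixth : reduces_to (5 / 6) (5 / 6 : R).
Proof. exact: reduces_toM (reduces_to_nat _ 5) rat_sixth. Qed.

Let half_risings_unit k : (k <= 2 * m)%N -> rising 2^-1 k \is a @GRing.unit R.
Proof. by move=> km; apply: rising_unit => i ik; apply: half_rising_unit; lia. Qed.

Let sum_term_half_pos_mod : \sum_(i < (2 * m).+1) term (u * 2^-1) i =
  (8 ^+ m * rising 2^-1 m / rising (3 / 2 + (2 * m)%:R) m) ^+ 2.
Proof.
have xE : u * 2^-1 = 2^-1 + (2 * m)%:R.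
  by apply: (eq_sub_mul (c := 2 * m%:R) h6); rewrite half uE natrM; ring.
have yE : 3 / 2 + (2 * m)%:R = 1 + u * (3 * h).
  by apply: (eq_sub_mul (c := 1 - 2 * m%:R) h6); rewrite half uE natrM; ring.
apply: (reduces_to_unique (q := \sum_(i < (2 * m).+1) term (2^-1 + (2 * m)%:R) i)).
  apply: reduces_to_sum_term_nilpotent (erefl _) _.
  by rewrite xE; apply: reduces_toD (reduces_to_nat _ _).
rewrite sum_term_half_pos; apply/reduces_toX/reduces_toM.
  apply: reduces_toM (reduces_to_rising _ rat_half).
  exact: reduces_toX (reduces_to_nat _ 8).
apply: reduces_toV.
  apply: rising_unit => i im.
  rewrite yE (_ : _ + i%:R = 1 + i%:R + u * (3 * h)); last by ring.
  by apply: unit_add_nilpotent; rewrite addrC natr1 natr_unit //; lia.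
apply/reduces_to_rising/reduces_toD; last exact: reduces_to_nat.
exact: reduces_toM (reduces_to_nat _ 3) rat_half.
Qed.

Let sum_term_half_neg_mod : \sum_(i < (2 * m).+1) term (- (u * 2^-1)) i =
  (rising m.+1%:R (2 * m) / (8 ^+ m * rising 2^-1 (2 * m))) ^+ 2.
Proof.
have xE : - (u * 2^-1) = - 2^-1 - (2 * m)%:R.
  by apply: (eq_sub_mul (c := - (2 * m%:R)) h6); rewrite half uE natrM; ring.
apply: (reduces_to_unique (q := \sum_(i < (2 * m).+1) term (- 2^-1 - (2 * m)%:R) i)).
  apply: (reduces_to_sum_term_nilpotent (c := - 2^-1)); first by rewrite mulrN.
  rewrite xE; apply: reduces_toD; first exact: reduces_toN.
  exact/reduces_toN/reduces_to_nat.
have m_gt0 : (0 < m)%N by lia.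
have := sum_term_half_neg rat m.-1; rewrite prednK // => ->; apply/reduces_toX/reduces_toM.
  exact/reduces_to_rising/reduces_to_nat.
apply: reduces_toV; first by rewrite unitrM unitrX // half_risings_unit.
apply: reduces_toM (reduces_to_rising _ rat_half).
exact: reduces_toX (reduces_to_nat _ 8).
Qed.

Let sum_term_sixth_1_mod j : m = (3 * j)%N ->
  \sum_(i < (2 * m).+1) term (- (u * 6^-1)) i =
  (rising 2^-1 m / (2 ^+ m * (rising h (2 * j) * rising (5 / 6) j))) ^+ 2.
Proof.
move=> mE; have xE : - (u * 6^-1) = - h - (2 * j)%:R.
  by apply: (eq_sub_mul (c := - (2 * j%:R)) h6); rewrite -/h uE mE !natrM; ring.
apply: (reduces_to_unique (q := \sum_(i < (2 * m).+1) term (- 6^-1 - (2 * j)%:R) i)).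
  apply: (reduces_to_sum_term_nilpotent (c := - 6^-1)); first by rewrite mulrN.
  rewrite xE; apply: reduces_toD; first exact: reduces_toN.
  exact/reduces_toN/reduces_to_nat.
have -> : (2 * m = 6 * j)%N by lia.
rewrite sum_term_sixth_1 -mE; apply/reduces_toX/reduces_toM; first exact: reduces_to_rising.
apply: reduces_toV.
  rewrite !unitrM unitrX //=; apply/andP; split; apply: rising_unit => i ij.
    by apply: (@sixth_unit 1); rewrite ?h6 // pE mE; lia.
  apply: (@sixth_unit 5); last by rewrite pE mE; lia.
  by rewrite five_sixth mulrBr h6; ring.
apply: reduces_toM; first exact: reduces_toX (reduces_to_nat _ 2).
by apply: reduces_toM; apply: reduces_to_rising.
Qed.

Let sum_term_sixth_5_mod j : m = (3 * j + 1)%N ->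
  \sum_(i < (2 * m).+1) term (- (u * 6^-1)) i =
  (rising 2^-1 m / (2 ^+ m * (rising (5 / 6) (2 * j) * rising h (j + 1)))) ^+ 2.
Proof.
move=> mE; have xE : - (u * 6^-1) = - (5 / 6) - (2 * j)%:R.
  apply: (eq_sub_mul (c := - (2 * j%:R)) h6).
  by rewrite -/h uE mE (natrD _ (3 * j)) !natrM; ring.
apply: (reduces_to_unique (q := \sum_(i < (2 * m).+1) term (- (5 / 6) - (2 * j)%:R) i)).
  apply: (reduces_to_sum_term_nilpotent (c := - 6^-1)); first by rewrite mulrN.
  rewrite xE; apply: reduces_toD; first exact: reduces_toN.
  exact/reduces_toN/reduces_to_nat.
have -> : (2 * m = 6 * j + 2)%N by lia.
rewrite sum_term_sixth_5 -mE; apply/reduces_toX/reduces_toM; first exact: reduces_to_rising.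
apply: reduces_toV.
  rewrite !unitrM unitrX //=; apply/andP; split; apply: rising_unit => i ij.
    apply: (@sixth_unit 5); last by rewrite pE mE; lia.
    by rewrite five_sixth mulrBr h6; ring.
  by apply: (@sixth_unit 1); rewrite ?h6 // pE mE; lia.
apply: reduces_toM; first exact: reduces_toX (reduces_to_nat _ 2).
by apply: reduces_toM; apply: reduces_to_rising.
Qed.

Lemma sum_term_zero_gam : \sum_(i < (2 * m).+1) term (0 : R) i = - (eps * gam 4^-1 ^+ 4).
Proof.
have B := sum_term_half_pos_mod; have A := sum_term_half_neg_mod.
have [j /orP[/eqP mE|/eqP mE]] : exists j, (m == 3 * j)%N || (m == 3 * j + 1)%N.
  (* The remaining class m = 3j + 2 would give p = 12j + 9. *)
  exists (m %/ 3)%N; suff : ~~ (3 %| p)%N by lia.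
  by rewrite dvdn_prime2 // neq_ltn p_gt3.
- exact: sum_term_zero B A (sum_term_sixth_1_mod mE) (sqr_rising_sixth_1 mE).
- exact: sum_term_zero B A (sum_term_sixth_5_mod mE) (sqr_rising_sixth_5 mE).
Qed.

End Points.
End ModCubeGamma.

Lemma reduces_to_rmorph (S T : comUnitRingType) (f : {rmorphism S -> T}) q x :
  reduces_to q x -> reduces_to q (f x).
Proof.
case=> n [d [du qE xE]]; exists n, d; split=> //.
  by rewrite -(rmorph_int f) rmorph_unit.
by rewrite -(rmorph_int f) -rmorphM xE rmorph_int.
Qed.

(** * From the p-adic integers to Z/p^3 *)

Section PadicResidue.
Variables (p : nat) (p_pr : prime p).
Local Notation Zp := (padic_int p_pr).

Lemma padic_natr_unit k : coprime k p -> (k%:R : Zp) \is a GRing.unit.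
Proof.
move=> kp.
have k_gt0 : (0 < k)%N.
  by case: k kp => //; rewrite /coprime gcd0n => /eqP p1; move: p_pr; rewrite p1.
(* Bezout gives an inverse modulo each power of p; uniqueness of inverses makes these compatible. *)
pose v n := (egcdn k (p ^ n)).1.
have kv n : (k * v n = 1 %[mod p ^ n])%N.
  rewrite /v; case: egcdnP => //= a b e _.
  by rewrite mulnC e (eqP (coprimeXr n kp)) modnMDl.
have vP n : (v n.+1 = v n %[mod p ^ n])%N.
  have e : (k * v n.+1 = 1 %[mod p ^ n])%N.
    by rewrite -(modn_dvdm _ (dvdn_exp2l p (leqnSn n))) kv modn_dvdm // dvdn_exp2l.
  by rewrite -[v n.+1]muln1 -modnMmr -(kv n) modnMmr mulnA [(_ * k)%N]mulnC -modnMml e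
    modnMml mul1n.
apply/unitrPr; exists (padic_mk p_pr vP); apply: padic_intP => n.
by rewrite /= residue_nat modnMml modnMmr kv.
Qed.

Lemma residue_modD (x : Zp) n k : (residue x (n + k) %% p ^ n)%N = residue x n.
Proof.
elim: k => [|k IH]; first by rewrite addn0 residue_mod.
by rewrite addnS -(modn_dvdm _ (dvdn_exp2l p (leq_addr k n))) residueP.
Qed.

Lemma padic_dvd_residue (x : Zp) k : residue x k = 0%N -> exists z, x = p%:R ^+ k * z.
Proof.
move=> xk; have dvd n : (p ^ k %| residue x (n + k))%N.
  elim: n => [|n IH]; first by rewrite xk.
  by apply/eqP; rewrite addSn -(modn_dvdm _ (dvdn_exp2l p (leq_addl n k))) residueP; apply/eqP.
have zP n : (residue x (n.+1 + k) %/ p ^ k = residue x (n + k) %/ p ^ k %[mod p ^ n])%N.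
  apply/eqP; rewrite -(@eqn_pmul2r (p ^ k)) ?expp_gt0 // !muln_modl divnK ?divnK //.
  by rewrite -expnD addSn; apply/eqP/residue_modS.
exists (padic_mk p_pr zP); apply: padic_intP => n.
by rewrite -natrX /= residue_nat modnMml modnMmr mulnC divnK // residue_modD.
Qed.

Definition reduce3 (x : Zp) : 'Z_(p ^ 3) := (residue x 3)%:R.

Let q_gt1 : (1 < p ^ 3)%N.
Proof. by rewrite -(expn0 p) ltn_exp2l ?prime_gt1. Qed.

Lemma natr_mod3 n : (n %% p ^ 3)%:R = n%:R :> 'Z_(p ^ 3).
Proof. by rewrite Zp_nat_mod. Qed.

Fact reduce3_zmod_morphism : zmod_morphism reduce3.
Proof.
move=> x y; rewrite /reduce3 /= natr_mod3 natrD natr_mod3 natrB ?(ltnW (residue_lt _ _)) //.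
by rewrite -(natr_mod3 (p ^ 3)) modnn sub0r.
Qed.

Fact reduce3_monoid_morphism : monoid_morphism reduce3.
Proof.
by split=> [|x y]; rewrite /reduce3 /= natr_mod3 // natrM.
Qed.

HB.instance Definition _ := GRing.isZmodMorphism.Build Zp 'Z_(p ^ 3) reduce3
  reduce3_zmod_morphism.
HB.instance Definition _ := GRing.isMonoidMorphism.Build Zp 'Z_(p ^ 3) reduce3
  reduce3_monoid_morphism.

Lemma reduce3_congruent (x y : Zp) : reduce3 x = reduce3 y -> congruent (p%:R ^+ 3) x y.
Proof.
move=> /eqP; rewrite -subr_eq0 -rmorphB => /eqP e; apply: padic_dvd_residue.
have := congr1 (fun z : 'Z_(p ^ 3) => (z : nat)) e.
by rewrite /reduce3 val_Zp_nat // residue_mod.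
Qed.

(** The index 0 is a multiple of p and contributes 1, so the product also gives the value 1 at n =
    0. *)
Definition morita3 (n : nat) : 'Z_(p ^ 3) :=
  (-1) ^+ n * \prod_(0 <= j < n) (if (p %| j)%N then 1 else j%:R).

Definition gamma3 (x : 'Z_(p ^ 3)) := morita3 x.

Hypothesis p_odd : odd p.

(** By Wilson's theorem modulo p^3 the extra factors multiply to -1, which the sign of the odd power
    p^3 compensates. *)
Lemma morita3_add n : morita3 (n + p ^ 3) = morita3 n.
Proof.
rewrite /morita3 exprD -[in (-1) ^+ (p ^ 3)]signr_odd oddX p_odd orbT expr1.
rewrite (@big_cat_nat _ _ _ n) ?leq_addr //=.
have -> : \prod_(n <= j < n + p ^ 3) (if (p %| j)%N then 1 else j%:R) = -1 :> 'Z_(p ^ 3).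
  have /dvdnP[c cE] := prod_window p_pr 3 n p_odd.
  apply/eqP; rewrite -subr_eq0 opprK.
  rewrite (_ : \prod_(n <= j < n + p ^ 3) _ =
    (\prod_(n <= j < n + p ^ 3 | ~~ (p %| j)) j)%N%:R); last first.
    by rewrite natr_prod [RHS]big_mkcond; apply: eq_bigr => j _; case: (p %| j)%N.
  by rewrite natr1 cE -natr_mod3 modnMl.
by move: (\prod_(0 <= j < n) _) => P; ring.
Qed.

Lemma gamma3_nat n : gamma3 n%:R = morita3 n.
Proof.
rewrite /gamma3 val_Zp_nat // [in RHS](divn_eq n (p ^ 3)) addnC.
by elim: (n %/ p ^ 3)%N => [|c IH]; rewrite ?addn0 // mulSnr addnA morita3_add.
Qed.

Lemma natr3_unit n : ((n%:R : 'Z_(p ^ 3)) \is a GRing.unit) = ~~ (p %| n)%N.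
Proof. by rewrite unitZpE // coprime_pexpl // prime_coprime. Qed.

Lemma gamma3S x : gamma3 (x + 1) = (if x \is a GRing.unit then - x else -1) * gamma3 x.
Proof.
rewrite -(natr_Zp x) natr1 !gamma3_nat natr3_unit /morita3 big_nat_recr //= exprS.
by case: (p %| x)%N => /=; ring.
Qed.

Lemma reduce3_padic_gamma (x : Zp) : reduce3 (padic_gamma x) = gamma3 (reduce3 x).
Proof.
have [Gc Gn] := padic_gammaP p_pr p_odd.
have := Gc x [set y | residue y 3 = residue (padic_gamma x) 3]%classic.
case=> [|m _ xm]; first by exists 3%N.
(* The level [m] comes from continuity at x, and level 3 fixes [reduce3 x]. Adding p^j makes n
   positive, as the defining product formula requires. *)
set j := maxn m 3; set n := (residue x j + p ^ j)%N.
have n_gt0 : (0 < n)%N by rewrite addn_gt0 expp_gt0 // orbT.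
have nx : residue (n%:R : Zp) j = residue x j by rewrite residue_nat modnDr residue_mod.
have e : reduce3 (padic_gamma x) = reduce3 (padic_gamma n%:R).
  by rewrite /reduce3 -(xm n%:R) //; apply: residue_le nx; rewrite leq_maxl.
have -> : reduce3 x = n%:R.
  by rewrite /reduce3 -(residue_le (leq_maxr m 3) nx) residue_nat natr_mod3.
rewrite e Gn // gamma3_nat /morita3 rmorphM rmorphXn rmorphN1; congr (_ * _).
rewrite rmorph_prod -(prednK n_gt0) [RHS]big_ltn // dvdn0 mul1r [LHS]big_mkcond.
by apply: eq_bigr => i _; rewrite rmorph_nat; case: (p %| i)%N.
Qed.

End PadicResidue.

(** * The truncated hypergeometric series and the congruence *)

Lemma hypergeometric_truncE (K : numFieldType) n :
  hypergeometric_trunc [:: 1 / 2; 1 / 2; 1 / 2] [:: 1; 1] (-1 / 8 : K) n =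
  \sum_(0 <= k < n.+1) rising_factorial (1 / 2) k ^+ 3 / k`!%:R ^+ 3 * (-1 / 8) ^+ k.
Proof.
rewrite /hypergeometric_trunc big_mkord; apply: eq_bigr => k _; rewrite !big_cons !big_nil.
have -> : rising_factorial (1 : K) k = k`!%:R.
  rewrite /rising_factorial; elim: (nat_of_ord k) => [|i IH]; first by rewrite big_ord0.
  by rewrite big_ord_recr /= IH factS natrM addrC natr1 mulrC.
have : k`!%:R != 0 :> K by rewrite pnatr_eq0 -lt0n fact_gt0.
move: (_ ^+ k) (k`!%:R) (rising_factorial _ _) => z f r f0.
by field.
Qed.

Lemma term_zero (K : numFieldType) k :
  term (0 : K) k = rising_factorial (1 / 2) k ^+ 3 / k`!%:R ^+ 3 * (-1 / 8) ^+ k.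
Proof.
elim: k => [|k IH].
  by rewrite term0 /rising_factorial big_ord0 expr0 fact0; field.
rewrite termS IH /rising_factorial big_ord_recr /= -/(rising_factorial _ _) factS natrM
  (exprS (-1 / 8)).
have : k`!%:R != 0 :> K by rewrite pnatr_eq0 -lt0n fact_gt0.
have : k.+1%:R != 0 :> K by rewrite pnatr_eq0.
rewrite /term_ratio -[k.+1%:R]natr1.
move: ((-1 / 8) ^+ k) (k`!%:R) (rising_factorial (1 / 2) k) (k%:R) => z f r x x0 f0.
by field; rewrite x0 f0.
Qed.

Theorem theorem5p4 (p : nat) (p_pr : prime p) (p_mod4 : (p = 1 %[mod 4])%N) :
  let F : rat :=
    hypergeometric_trunc [:: 1 / 2; 1 / 2; 1 / 2] [:: 1; 1] (-1 / 8) ((p - 1) %/ 2)%N in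
  F = \sum_(0 <= k < ((p - 1) %/ 2).+1)
        rising_factorial (1 / 2) k ^+ 3 / k`!%:R ^+ 3 * (-1 / 8) ^+ k
  /\ congruent (p%:R ^+ 3 : padic_int p_pr)
       (ratr F)
       (- (-1) ^+ ((p ^ 2 - 1) %/ 8)%N * padic_gamma (1 / 4) ^+ 4).
Proof.
have [m pE] : exists m, p = (4 * m + 1)%N by exists (p %/ 4)%N; lia.
have p_gt1 := prime_gt1 p_pr; have p_gt3 : (3 < p)%N by lia.
have p_odd : odd p by lia.
move=> F; have FE : F = \sum_(i < (2 * m).+1) term 0 i.
  rewrite /F hypergeometric_truncE big_mkord (_ : (p - 1) %/ 2 = 2 * m)%N; last by lia.
  by apply: eq_bigr => i _; rewrite term_zero.
split; first exact: hypergeometric_truncE.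
(* Used in Z_p, where it identifies [ratr F], and in Z/p^3; uniqueness of the reduction then gives
   the image of [ratr F] under [reduce3]. *)
have F_reduces (S : comUnitRingType) :
    (forall k, (0 < k < p)%N -> (k%:R : S) \is a GRing.unit) ->
    reduces_to F (\sum_(i < (2 * m).+1) term (0 : S) i).
  move=> uS; rewrite FE; have u1 i : (i < 2 * m)%N -> 1 + i%:R \is a @GRing.unit S.
    by move=> im; rewrite addrC natr1 uS //; lia.
  apply: reduces_to_sum_term; rewrite ?mulr0 ?addr0 //; first by apply: uS; lia.
  exact: (reduces_to_nat _ 0).
have padic_unit k : (0 < k < p)%N -> (k%:R : padic_int p_pr) \is a GRing.unit.
  move=> /andP[k0 kp]; apply: padic_natr_unit.
  by rewrite coprime_sym prime_coprime // gtnNdvd.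
apply: reduce3_congruent.
have mod3_unit k : (0 < k < p)%N -> (k%:R : 'Z_(p ^ 3)) \is a GRing.unit.
  by move=> /andP[k0 kp]; rewrite natr3_unit // gtnNdvd.
have := reduces_to_rmorph (@reduce3 p p_pr) (F_reduces _ padic_unit).
rewrite (reduces_to_ratr (F_reduces _ padic_unit)).
move/(reduces_to_unique (F_reduces _ mod3_unit)) => <-.
have [d dE] := two_expn_mod p_pr pE.
have p3 : (p%:R : 'Z_(p ^ 3)) ^+ 3 = 0 by rewrite -natrX -(natr_mod3 p_pr (p ^ 3)) modnn.
have natR (x : 'Z_(p ^ 3)) : exists n, x = n%:R by exists x; rewrite natr_Zp.
have gam0 : @gamma3 p 0 = 1 by rewrite /gamma3 /morita3 big_geq // mulr1.
have eps2 : ((-1) ^+ m) ^+ 2 = 1 :> 'Z_(p ^ 3) by rewrite exprAC sqrrN !expr1n.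
have two_pow : 2 ^+ (2 * m) = (-1) ^+ m * (1 + p%:R * d%:~R) :> 'Z_(p ^ 3).
  by move: (congr1 (fun z : int => z%:~R : 'Z_(p ^ 3)) dE);
    rewrite rmorphM rmorphD rmorphM !rmorphXn rmorphN1 /= => ->.
rewrite (sum_term_zero_gam p_pr p_gt3 natR (natr3_unit p_pr) p3 gam0 (gamma3S p_pr p_odd)
  pE eps2 two_pow).
rewrite rmorphM rmorphN !rmorphXn rmorphN1 /= reduce3_padic_gamma // mulNr.
(* This exponent has the parity of m, so the sign of the theorem is (-1)^m. *)
have -> : ((p ^ 2 - 1) %/ 8 = 2 * m ^ 2 + m)%N.
  have -> : (p ^ 2 - 1 = (2 * m ^ 2 + m) * 8)%N by rewrite pE; lia.
  by rewrite mulnK.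
have four_unit : (4%:R : padic_int p_pr) \is a GRing.unit by apply: padic_unit; lia.
by rewrite div1r rmorphV // rmorph_nat exprD exprM sqrrN !expr1n mul1r.
Qed.
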